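(* The involution $\mathcal{I}_{\mathcal{F}}$ associated to a generic quadratic (i.e. degree $2$) foliation $\mathcal{F}$ on $\mathbb{P}^2(\mathbb{C})$ is a Geiser involution.
   Context: ''Generic'' means: for $\mathcal{F}$ in some non-empty Zariski open subset of the space of degree $2$ foliations on $\mathbb{P}^2(\mathbb{C})$. Foliations: a foliation $\mathcal{F}$ of degree $\nu$ on $\mathbb{P}^2(\mathbb{C})$ is given, up to a nonzero scalar, by a $1$-form $\omega=u\,dx+v\,dy+w\,dz$ on $\mathbb{C}^3$, with $u,v,w$ homogeneous polynomials of degree $\nu+1$ without common factor satisfying $xu+yv+zw=0$. The degree $\nu$ is the number of tangency points of $\mathcal{F}$ with a generic line. $\mathcal{L}_m$ denotes the leaf of $\mathcal{F}$ through a regular point $m$ and $T_m\mathcal{L}_m$ its (projective) tangent line at $m$. Involution associated to a quadratic foliation: if $\mathcal{F}$ has degree $2$ and $m$ is a generic point, the line $T_m\mathcal{L}_m$ is tangent to $\mathcal{F}$ at $m$ and at exactly one second point $m'$; $\mathcal{I}_{\mathcal{F}}$ is the birational involution of $\mathbb{P}^2(\mathbb{C})$ defined by $m\mapsto m'$. Geiser involution: let $p_1,\ldots,p_7$ be seven points of $\mathbb{P}^2(\mathbb{C})$ in general position (no three collinear, no six on a conic). Let $L$ be the linear system (of projective dimension $2$) of cubics through $p_1,\ldots,p_7$. For a generic point $p$, the elements of $L$ passing through $p$ form a pencil with nine base points: $p_1,\dots,p_7$, $p$ and a ninth one, denoted $\mathcal{I}_G(p)$. The map $p\mapsto\mathcal{I}_G(p)$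 is a birational involution; any involution obtained in this way is called a Geiser involution. *)

(* Defs.v *)
From HB Require Import structures.
From mathcomp Require Import all_boot all_order all_algebra.
From mathcomp.multinomials Require Import mpoly.
Set Implicit Arguments.
Unset Strict Implicit.
Unset Printing Implicit Defensive.
Import GRing.Theory.
Local Open Scope ring_scope.

(* Everything here is stated over a field K.  A point of the projective space
   P^(n-1)(K) is given by homogeneous coordinates, i.e. a nonzero row vector of
   size n; two such vectors define the same point iff they have the same row
   space, written (x == y)%MS. *)

Section Projective.

Variable K : fieldType.

(* In the sets below only nonzero vectors matter. *)
Definition zariski_open (n : nat) (U : 'rV[K]_n -> Prop) : Prop :=
  exists2 S : {mpoly K[n]} -> Prop,
    forall G, S G -> exists d : nat, G \is d.-homog
  & forall x : 'rV[K]_n, x != 0 ->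
      (U x <-> exists2 G, S G & G.@[x 0] != 0).

(* P holds for a generic element of the family X, topologized through its
   homogeneous coordinates coord: P holds on the trace on X of some Zariski
   open set, and this trace is not empty. *)
Definition generically (n : nat) (T : Type) (X : T -> Prop)
    (coord : T -> 'rV[K]_n) (P : T -> Prop) : Prop :=
  exists U : 'rV[K]_n -> Prop,
    [/\ zariski_open U,
        exists2 x, X x & U (coord x)
      & forall x, X x -> U (coord x) -> P x].

Definition generic_point (P : 'rV[K]_3 -> Prop) : Prop :=
  generically (fun m : 'rV[K]_3 => m != 0) id P.

Definition eval_forms (F : 'I_3 -> {mpoly K[3]}) (x : 'rV[K]_3) : 'rV[K]_3 :=
  \row_i (F i).@[x 0].

(* Rational self-maps of P^2, given by three forms of the same degree (common
   factors are allowed); phi is defined at x when eval_forms phi x != 0. *)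
Definition rational_map (phi : 'I_3 -> {mpoly K[3]}) : Prop :=
  (exists d : nat, forall i, phi i \is d.-homog) /\ (exists i, phi i != 0).

Definition birational_involution (phi : 'I_3 -> {mpoly K[3]}) : Prop :=
  rational_map phi /\
  generic_point (fun m =>
    let m' := eval_forms phi m in
    [/\ m' != 0, eval_forms phi m' != 0 & (eval_forms phi m' == m)%MS]).

End Projective.

Section Foliations.

Variable K : fieldType.
Implicit Types (F phi : 'I_3 -> {mpoly K[3]}) (m q : 'rV[K]_3).

(* The triple F = (u, v, w) stands for the 1-form u dx + v dy + w dz.
   Proportional triples define the same foliation; all notions below are
   invariant under rescaling F. *)
Definition is_foliation (nu : nat) F : Prop :=
  [/\ forall i, F i \is (nu.+1).-homog,
      \sum_(i < 3) 'X_i * F i = 0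
    & forall d : {mpoly K[3]},
        (forall i, exists a, F i = d * a) -> d \is a GRing.unit].

(* Homogeneous coordinates of F in the space of foliations of degree nu: the
   coefficients of u, v, w.  The index type lists all monomials of degree at
   most nu + 1; those of smaller degree only contribute zero coordinates. *)
Definition foliation_coords (nu : nat) F :
    'rV[K]_#|{: 'I_3 * 'X_{1..3 < nu.+2}}| :=
  \row_(k < #|{: 'I_3 * 'X_{1..3 < nu.+2}}|)
    let im : 'I_3 * 'X_{1..3 < nu.+2} := enum_val k in (F im.1)@_(im.2).

Definition generic_foliation (nu : nat)
    (P : ('I_3 -> {mpoly K[3]}) -> Prop) : Prop :=
  generically (is_foliation nu) (foliation_coords nu) P.

Definition regular_point F m : Prop := m != 0 /\ eval_forms F m != 0.

(* The line T_m L_m = { q | u(m) q_0 + v(m) q_1 + w(m) q_2 = 0 }, as the row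
   space of a matrix: q lies on it iff (q <= tangent_line F m)%MS. *)
Definition tangent_line F m : 'M[K]_3 := kermx (eval_forms F m)^T.

Definition tangent_at F (l : 'M[K]_3) q : Prop :=
  regular_point F q /\ (tangent_line F q == l)%MS.

Definition associated_involution F phi : Prop :=
  birational_involution phi /\
  generic_point (fun m =>
    let m' := eval_forms phi m in
    let l := tangent_line F m in
    [/\ tangent_at F l m, tangent_at F l m', ~~ (m' == m)%MS
      & forall q, tangent_at F l q -> (q == m)%MS \/ (q == m')%MS]).

End Foliations.

Section Geiser.

Variable K : fieldType.
Implicit Types (phi : 'I_3 -> {mpoly K[3]}) (m q : 'rV[K]_3).

Definition no_subset_on_curve (n k d : nat) (p : 'I_n -> 'rV[K]_3) : Prop :=
  forall A : {set 'I_n}, #|A| = k ->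
    ~ exists f : {mpoly K[3]},
        [/\ f != 0, f \is d.-homog & forall i, i \in A -> f.@[p i 0] = 0].

(* No three of the seven points on a line, no six on a conic. *)
Definition general_position (p : 'I_7 -> 'rV[K]_3) : Prop :=
  [/\ forall i, p i != 0,
      forall i j, i != j -> ~~ (p i == p j)%MS,
      no_subset_on_curve 3 1 p
    & no_subset_on_curve 6 2 p].

Definition cubic_through (p : 'I_7 -> 'rV[K]_3) (f : {mpoly K[3]}) : Prop :=
  f \is 3.-homog /\ forall i, f.@[p i 0] = 0.

Definition base_point (p : 'I_7 -> 'rV[K]_3) m q : Prop :=
  q != 0 /\
  forall f, cubic_through p f -> f.@[m 0] = 0 -> f.@[q 0] = 0.

(* For generic m the nine base points are pairwise distinct. *)
Definition geiser_involution phi : Prop :=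
  birational_involution phi /\
  exists2 p : 'I_7 -> 'rV[K]_3, general_position p &
    generic_point (fun m =>
      let m' := eval_forms phi m in
      [/\ m' != 0, ~~ (m' == m)%MS,
          forall i, ~~ (m == p i)%MS /\ ~~ (m' == p i)%MS
        & forall q, base_point p m q <->
            q != 0 /\
            [\/ exists i, (q == p i)%MS, (q == m)%MS | (q == m')%MS]]).

End Geiser.

(* Main.v *)
Require Import Defs.
From HB Require Import structures.
From mathcomp Require Import all_boot all_order all_algebra.
From mathcomp.multinomials Require Import mpoly.
From mathcomp.real_closed Require Import complex.
From mathcomp Require Import reals boolp.
From mathcomp Require Import ring zify perm separable cyclotomic.
Set Implicit Arguments.
Unset Strict Implicit.
Unset Printing Implicit Defensive.
Import GRing.Theory Num.Theory.
Local Open Scope ring_scope.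

(** At a point m, a quadratic foliation is given by omega(m) = m x P(m) for a
    quadratic vector field P of K^3, unique up to a linear form times m
    ([foliation_eval]).  A regular point q <> m is tangent to the tangent line
    of m iff omega(q) is proportional to omega(m).  That line is spanned by m
    and P(m), and m . omega (s m + t P(m)) = t^2 (s T + t S) there, for two
    forms S and T in m: the root t = 0 is m itself, and the only other tangency
    point is m' = S m - T P(m).  Exchanging m and m' is the involution
    ([tangent_points], [involution_involutive]).

    The components of omega are cubics through the singular points.  When no
    line is invariant, no three singular points are collinear, seven of them
    impose independent conditions on cubics, and so the cubics through seven
    singular points are exactly the combinations a . omega
    ([cubic_through_span]).  It follows that six of them never lie on a conic
    and that there is no eighth one ([six_not_on_conic], [singular_in_config]).
    A point q is a base point of the pencil of the cubics that vanish at m iff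
    every a orthogonal to omega(m) is orthogonal to omega(q), that is, iff
    omega(q) is zero or proportional to omega(m).  Hence the base points are the
    seven singular points, m and m', and the involution is the Geiser involution
    of the singular points ([base_point_singular], [associated_geiser]).

    What remains is to express the assumptions by the nonvanishing of forms in
    the coefficients.  The lines that are invariant are the common zeros of six
    cubic forms in the coordinates of the line; a nonzero determinant says that
    the multiples of these cubics fill the space of quartics, so that there is
    no common zero ([line_cert_no_invariant_line]).  Eliminating y from the
    equations of the singular points (x : y : 1) leaves a polynomial of degree 7
    in x; a nonzero discriminant gives seven singular points
    ([exists_singular_config]).  A last condition says that the involution is
    defined at one point.  All of them hold for the Jouanolou foliation,
    P = (y^2, z^2, x^2), whose singular points are (t : t^5 : 1) with t^7 = 1
    ([jouanolou_foliation], [generic_fun_jouanolou]). *)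

(** * Vectors of K^3 *)

Notation ix := (@ord0 2).
Notation iy := (lift ord0 (@ord0 1)).
Notation iz := (lift ord0 (lift ord0 (@ord0 0))).

Section Vectors.
Variable K : fieldType.
Implicit Types (a b c m q v : 'rV[K]_3) (s t : K).

Definition v3 (x y z : K) : 'rV[K]_3 := \row_i [:: x; y; z]`_i.

Definition dot a b : K := a 0 ix * b 0 ix + a 0 iy * b 0 iy + a 0 iz * b 0 iz.

Definition cross a b : 'rV[K]_3 :=
  v3 (a 0 iy * b 0 iz - a 0 iz * b 0 iy)
     (a 0 iz * b 0 ix - a 0 ix * b 0 iz)
     (a 0 ix * b 0 iy - a 0 iy * b 0 ix).

Lemma row3P a b :
  a 0 ix = b 0 ix -> a 0 iy = b 0 iy -> a 0 iz = b 0 iz -> a = b.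
Proof.
move=> h0 h1 h2; apply/rowP => -[[|[|[|//]]] lt_i3].
- by rewrite (_ : Ordinal lt_i3 = ix) //; apply: val_inj.
- by rewrite (_ : Ordinal lt_i3 = iy) //; apply: val_inj.
- by rewrite (_ : Ordinal lt_i3 = iz) //; apply: val_inj.
Qed.

End Vectors.

Ltac vec := apply: row3P; rewrite /cross /dot /v3 ?mxE /=; ring.
Ltac sca := rewrite /cross /dot /v3 ?mxE /=; ring.

Section VectorAlgebra.
Variable K : fieldType.
Implicit Types (a b c m q v : 'rV[K]_3) (s t : K).

Lemma I3_ind (P : 'I_3 -> Prop) : P ix -> P iy -> P iz -> forall i, P i.
Proof.
move=> h0 h1 h2 [[|[|[|//]]] lt_i3].
- by rewrite (_ : Ordinal lt_i3 = ix) //; apply: val_inj.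
- by rewrite (_ : Ordinal lt_i3 = iy) //; apply: val_inj.
- by rewrite (_ : Ordinal lt_i3 = iz) //; apply: val_inj.
Qed.

Lemma sum3 (V : nmodType) (f : 'I_3 -> V) : \sum_i f i = f ix + f iy + f iz.
Proof. by rewrite !big_ord_recl big_ord0 addr0 addrA. Qed.

Lemma dotC a b : dot a b = dot b a. Proof. sca. Qed.
Lemma dotDr a b c : dot a (b + c) = dot a b + dot a c. Proof. sca. Qed.
Lemma dotZr s a b : dot a (s *: b) = s * dot a b. Proof. sca. Qed.
Lemma dotDl a b c : dot (a + b) c = dot a c + dot b c. Proof. sca. Qed.
Lemma dotZl s a b : dot (s *: a) b = s * dot a b. Proof. sca. Qed.
Lemma dot0r a : dot a 0 = 0. Proof. sca. Qed.
Lemma dot0l a : dot 0 a = 0. Proof. sca. Qed.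
Lemma crossC a b : cross a b = - cross b a. Proof. vec. Qed.
Lemma crossDr a b c : cross a (b + c) = cross a b + cross a c. Proof. vec. Qed.
Lemma crossZr s a b : cross a (s *: b) = s *: cross a b. Proof. vec. Qed.
Lemma crossDl a b c : cross (a + b) c = cross a c + cross b c. Proof. vec. Qed.
Lemma crossZl s a b : cross (s *: a) b = s *: cross a b. Proof. vec. Qed.
Lemma crossvv a : cross a a = 0. Proof. vec. Qed.
Lemma cross0r a : cross a 0 = 0. Proof. vec. Qed.
Lemma cross0l a : cross 0 a = 0. Proof. vec. Qed.
Lemma dot_crossl a b : dot a (cross a b) = 0. Proof. sca. Qed.
Lemma dot_crossr a b : dot b (cross a b) = 0. Proof. sca. Qed.
Lemma dot_crossC a b c : dot a (cross b c) = dot b (cross c a). Proof. sca. Qed.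
Lemma cross_cross a b c : cross (cross a b) c = dot a c *: b - dot b c *: a.
Proof. vec. Qed.

Lemma dotrE a b : (a *m b^T) 0 0 = dot a b.
Proof. by rewrite mxE sum3 !mxE /dot. Qed.

Lemma dot_eq0 a : (forall b, dot a b = 0) -> a = 0.
Proof.
move=> a0; apply: row3P.
- by have := a0 (v3 1 0 0); rewrite /dot !mxE /= !mulr0 mulr1 !addr0.
- by have := a0 (v3 0 1 0); rewrite /dot !mxE /= !mulr0 mulr1 addr0 add0r.
- by have := a0 (v3 0 0 1); rewrite /dot !mxE /= !mulr0 mulr1 !add0r.
Qed.

Lemma exists_dot_neq0 a : a != 0 -> exists b, dot a b != 0.
Proof.
move=> a_neq0; have [i ai] : exists i, a 0 i != 0 by apply/rV0Pn.
exists (delta_mx 0 i); rewrite -dotrE trmx_delta -colE mxE //.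
Qed.

Lemma cross_eq0_colinear a b : a != 0 -> cross a b = 0 -> exists s, b = s *: a.
Proof.
move=> /exists_dot_neq0[c ac] ab0; exists (dot b c / dot a c).
have := cross_cross a b c; rewrite ab0 cross0l => /esym/subr0_eq abc.
by rewrite mulrC -scalerA -abc scalerA mulVf // scale1r.
Qed.

Lemma cramer3 a b c v :
  dot (cross a b) c *: v =
  dot (cross v b) c *: a + dot (cross a v) c *: b + dot v (cross a b) *: c.
Proof. vec. Qed.

Lemma orth_cross_span a b v :
  cross a b != 0 -> dot v (cross a b) = 0 -> exists s t, v = s *: a + t *: b.
Proof.
move=> /exists_dot_neq0[c abc] vab; have := cramer3 a b c v.
rewrite vab scale0r addr0 => /(congr1 ( *:%R (dot (cross a b) c)^-1)).
by rewrite scalerDr !scalerA mulVf // scale1r => ->; do 2!eexists.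
Qed.

(** The witnesses depend on a nonzero coordinate of [v]: as [v] may be
    isotropic, there is no uniform choice of vectors orthogonal to [v]. *)
Lemma exists_cross_basis v : v != 0 -> exists a b, cross a b = v.
Proof.
move=> v0; have [i vi] : exists i, v 0 i != 0 by apply/rV0Pn.
elim/I3_ind: i vi => vi.
- exists (v3 (v 0 iz) 0 (- v 0 ix)), (v3 (- v 0 iy / v 0 ix) 1 0).
  by apply: row3P; rewrite /cross /v3 !mxE /=; field.
- exists (v3 (- v 0 iy) (v 0 ix) 0), (v3 0 (- v 0 iz / v 0 iy) 1).
  by apply: row3P; rewrite /cross /v3 !mxE /=; field.
- exists (v3 0 (- v 0 iz) (v 0 iy)), (v3 1 0 (- v 0 ix / v 0 iz)).
  by apply: row3P; rewrite /cross /v3 !mxE /=; field.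
Qed.

Lemma eqmx_rowP a b : a != 0 -> b != 0 ->
  reflect (exists s, b = s *: a) (a == b)%MS.
Proof.
move=> a0 b0; apply: (iffP idP) => [/andP[_ /sub_rVP] //|[s bE]].
have s0 : s != 0 by apply: contraNneq b0 => s0; rewrite bE s0 scale0r.
by rewrite bE; apply/eqmxP/eqmx_sym/eqmx_scale.
Qed.

Lemma eqmx_cross a b : a != 0 -> b != 0 -> (a == b)%MS = (cross a b == 0).
Proof.
move=> a0 b0; apply/eqmx_rowP/eqP => // [[s ->]|]; last exact: cross_eq0_colinear.
by rewrite crossZr crossvv scaler0.
Qed.

Lemma eqmx_kermx_rowP a b : a != 0 -> b != 0 ->
  (kermx a^T == kermx b^T)%MS = (cross a b == 0).
Proof.
move=> a0 b0; apply/idP/eqP => [/andP[ab _]|].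
  apply: dot_eq0 => c.
  have : (cross a c <= kermx a^T)%MS.
    by apply/sub_kermxP/rowP => i; rewrite ord1 dotrE mxE dotC dot_crossl.
  move=> /submx_trans/(_ ab)/sub_kermxP/rowP/(_ 0); rewrite dotrE mxE => abc.
  by rewrite -[0]oppr0 -abc; sca.
move=> /(cross_eq0_colinear a0)[s bE].
have s0 : s != 0 by apply: contraNneq b0 => s0; rewrite bE s0 scale0r.
rewrite bE linearZ /=; apply/andP; split; apply/sub_kermxP.
  by rewrite -scalemxAr mulmx_ker scaler0.
apply: (scalerI s0); rewrite scaler0 scalemxAr; exact: mulmx_ker.
Qed.
End VectorAlgebra.

(** * Quadratic vector fields and the second tangency point *)

Notation "c %( i , j )" := (c i%N j%N)
  (at level 1, left associativity, only parsing).

Section QuadraticFields.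
Variable K : fieldType.
Implicit Types (c : nat -> nat -> K) (m n p q r l a b : 'rV[K]_3) (s t : K).

(** The field P.  Adding a linear form times m to P does not change the
    foliation, so x^2, y^2 and z^2 are dropped from the first, second and third
    component; the 15 other coefficients are listed cyclically under
    x -> y -> z -> x. *)
Definition quad c m : 'rV[K]_3 :=
  let x := m 0 ix in let y := m 0 iy in let z := m 0 iz in
  v3 (c%(0,0) * y ^+ 2 + c%(0,1) * (y * z) + c%(0,2) * z ^+ 2
        + c%(0,3) * (x * y) + c%(0,4) * (x * z))
     (c%(1,0) * z ^+ 2 + c%(1,1) * (z * x) + c%(1,2) * x ^+ 2
        + c%(1,3) * (y * z) + c%(1,4) * (y * x))
     (c%(2,0) * x ^+ 2 + c%(2,1) * (x * y) + c%(2,2) * y ^+ 2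
        + c%(2,3) * (z * x) + c%(2,4) * (z * y)).

(** Twice the symmetric bilinear map of [quad], so that [polar c m m] is
    [2 *: quad c m]. *)
Definition polar c m n : 'rV[K]_3 :=
  let x := m 0 ix in let y := m 0 iy in let z := m 0 iz in
  let x' := n 0 ix in let y' := n 0 iy in let z' := n 0 iz in
  v3 (c%(0,0) * (y * y' *+ 2) + c%(0,1) * (y * z' + y' * z)
        + c%(0,2) * (z * z' *+ 2)
        + c%(0,3) * (x * y' + x' * y) + c%(0,4) * (x * z' + x' * z))
     (c%(1,0) * (z * z' *+ 2) + c%(1,1) * (z * x' + z' * x)
        + c%(1,2) * (x * x' *+ 2)
        + c%(1,3) * (y * z' + y' * z) + c%(1,4) * (y * x' + y' * x))
     (c%(2,0) * (x * x' *+ 2) + c%(2,1) * (x * y' + x' * y)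
        + c%(2,2) * (y * y' *+ 2)
        + c%(2,3) * (z * x' + z' * x) + c%(2,4) * (z * y' + z' * y)).

Definition omega c m : 'rV[K]_3 := cross m (quad c m).

Lemma quadDZ c s t m n :
  quad c (s *: m + t *: n) =
  s ^+ 2 *: quad c m + (s * t) *: polar c m n + t ^+ 2 *: quad c n.
Proof. rewrite /quad /polar; vec. Qed.

Lemma quadD c m n : quad c (m + n) = quad c m + polar c m n + quad c n.
Proof. by have := quadDZ c 1 1 m n; rewrite !scale1r expr1n mulr1 !scale1r. Qed.

Lemma quadZ c s m : quad c (s *: m) = s ^+ 2 *: quad c m.
Proof. by have := quadDZ c s 0 m 0; rewrite mulr0 expr0n !scale0r !addr0. Qed.

Lemma omegaZ c s m : omega c (s *: m) = s ^+ 3 *: omega c m.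
Proof. by rewrite /omega quadZ crossZl crossZr scalerA -exprS. Qed.

Lemma dot_omega c m : dot m (omega c m) = 0.
Proof. exact: dot_crossl. Qed.

Lemma cross_orth a b v : dot v a = 0 -> dot v b = 0 -> cross v (cross a b) = 0.
Proof.
move=> va vb; rewrite crossC cross_cross (dotC a) (dotC b) va vb.
by rewrite !scale0r subr0 oppr0.
Qed.

Lemma cross_eq0_sym a b : cross a b = 0 -> cross b a = 0.
Proof. by move=> ab0; rewrite crossC ab0 oppr0. Qed.

(** The coefficients of the equation s T + t S = 0 of the second tangency point
    s m + t P(m) on the tangent line of m. *)
Definition tanS c m := dot (omega c m) (quad c (quad c m)).
Definition tanT c m := dot (omega c m) (polar c m (quad c m)).
Definition involution c m := tanS c m *: m - tanT c m *: quad c m.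

(** With q = s m + t P(m), the left side is the determinant of m, q and P(q),
    that is t omega(m) . P(q); and the term s^2 P(m) of P(q) is orthogonal to
    omega(m). *)
Lemma dot_omega_tangent c m s t :
  dot m (omega c (s *: m + t *: quad c m)) = t ^+ 2 * (s * tanT c m + t * tanS c m).
Proof.
rewrite {1}/omega quadDZ crossDl !crossZl dotDr !dotZr dot_crossl mulr0 add0r.
rewrite dot_crossC dot_crossC -/(omega c m) dotC !dotDr !dotZr.
rewrite [dot _ (quad c m)]dotC /omega dot_crossr -/(omega c m) /tanT /tanS; ring.
Qed.

Lemma omega_neq0 c m : tanT c m != 0 -> omega c m != 0.
Proof. by apply: contraNneq => f0; rewrite /tanT f0 dot0l. Qed.

Lemma cross_involution c m : cross m (involution c m) = - tanT c m *: omega c m.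
Proof.
by rewrite /involution -scaleNr crossDr !crossZr crossvv scaler0 add0r.
Qed.

Lemma cross_involution_neq0 c m : tanT c m != 0 -> cross m (involution c m) != 0.
Proof.
by move=> T0; rewrite cross_involution scaler_eq0 oppr_eq0 negb_or T0 omega_neq0.
Qed.

Lemma involution_neq0 c m : tanT c m != 0 -> involution c m != 0.
Proof.
by move=> /cross_involution_neq0; apply: contraNneq => ->; rewrite cross0r.
Qed.

(** The covector omega(m') is orthogonal to m' and, by the choice of m', to m;
    these two vectors span the tangent line of m. *)
Lemma omega_involution_colinear c m :
  tanT c m != 0 -> cross (omega c (involution c m)) (omega c m) = 0.
Proof.
move=> T0; apply: (@scalerI _ _ (- tanT c m)); first by rewrite oppr_eq0.
rewrite scaler0 -crossZr -cross_involution; apply: cross_orth.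
  rewrite dotC /involution -scaleNr dot_omega_tangent; ring.
by rewrite dotC dot_omega.
Qed.

(** Such a q lies on the tangent line of m, and the binary form
    t^2 (s T + t S) vanishes at it. *)
Lemma tangent_points c m q :
  tanT c m != 0 -> omega c q != 0 -> cross (omega c q) (omega c m) = 0 ->
  cross q m = 0 \/ cross q (involution c m) = 0.
Proof.
move=> T0 q0 qm; have fm0 := omega_neq0 T0.
have [k mE] := cross_eq0_colinear q0 qm.
have qm0 : dot q (omega c m) = 0 by rewrite mE dotZr dot_omega mulr0.
have [s [t qE]] := orth_cross_span fm0 qm0.
have [k' qE'] := cross_eq0_colinear fm0 (cross_eq0_sym qm).
have := dot_omega_tangent c m s t.
rewrite -qE qE' dotZr dot_omega mulr0 => /esym/eqP.
rewrite mulf_eq0 expf_eq0 /= => /orP[/eqP t0|/eqP stE].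
  by left; rewrite qE t0 scale0r addr0 crossZl crossvv scaler0.
right; rewrite qE /involution crossDl !crossZl !crossDr -scaleNr !crossZr !crossvv.
rewrite [cross (quad c m) m]crossC -/(omega c m) !scaler0 addr0 add0r !scalerA.
rewrite scalerN -scaleNr -scalerDl.
by rewrite mulrN -opprD stE oppr0 scale0r.
Qed.

(** The point m is tangent to the tangent line of m', so it is one of the two
    tangency points computed from m', as soon as T(m') <> 0.  If T(m') = 0, then
    S(m') = 0 because m is tangent, and omega(m) . P vanishes on the whole line;
    but T(m) is the value of its polar form at m and P(m). *)
Lemma involution_involutive c m : tanT c m != 0 -> omega c (involution c m) != 0 ->
  involution c (involution c m) != 0 /\ cross (involution c (involution c m)) m = 0.
Proof.
move=> T0 f'0; set m' := involution c m.
have fm0 := omega_neq0 T0.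
have fmm' := cross_eq0_sym (omega_involution_colinear T0).
have [k fE] := cross_eq0_colinear f'0 (omega_involution_colinear T0).
have nmm' : cross m' m != 0.
  by rewrite crossC oppr_eq0 cross_involution_neq0.
suff T'0 : tanT c m' != 0.
  split; first exact: involution_neq0.
  have [/cross_eq0_sym mm'|/cross_eq0_sym//] := tangent_points T'0 fm0 fmm'.
  by rewrite mm' eqxx in nmm'.
apply/negP => /eqP T'0.
have mE : dot m (omega c m') = 0.
  have [k' ->] := cross_eq0_colinear fm0 fmm'.
  by rewrite dotZr dot_omega mulr0.
have [s [t mpE]] := orth_cross_span f'0 mE.
have t0 : t != 0.
  apply: contraNneq nmm' => t0.
  by rewrite mpE t0 scale0r addr0 crossZr crossvv scaler0.
have S'0 : tanS c m' = 0.
  have := dot_omega_tangent c m' s t; rewrite -mpE fE dotZr dot_omega mulr0 T'0.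
  rewrite mulr0 add0r => /esym/eqP.
  by rewrite !(mulf_eq0, expf_eq0) /= (negbTE t0) /= => /eqP.
have line0 q : dot q (omega c m) = 0 -> dot (omega c m) (quad c q) = 0.
  rewrite fE dotZr dotZl => /eqP; rewrite mulf_eq0 => /orP[/eqP ->|/eqP qm'].
    by rewrite mul0r.
  have [s' [t' ->]] := orth_cross_span f'0 qm'.
  rewrite quadDZ !dotDr !dotZr -/(tanT c m') -/(tanS c m') T'0 S'0.
  by rewrite [dot _ (quad c m')]dotC dot_crossr !mulr0 !addr0 mulr0.
have := line0 (m + quad c m).
rewrite quadD !dotDr -/(tanT c m) !line0 ?dot_omega ?dot_crossr // dotDl dot_omega.
by rewrite dot_crossr !addr0 add0r => /(_ erefl) T1; rewrite T1 eqxx in T0.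
Qed.
End QuadraticFields.

(** * Consequences of the absence of invariant lines *)

Section NoInvariantLine.
Variable K : numClosedFieldType.
Implicit Types (c : nat -> nat -> K) (m n p q r l a b v : 'rV[K]_3) (s t : K).

(** The line spanned by a and b has the equation l = a x b.  The three equations
    say that l . P (s a + t b) is identically zero, i.e. that P is tangent to
    the line at each of its points. *)
Definition no_invariant_line c := forall a b, cross a b != 0 ->
  ~ [/\ dot (cross a b) (quad c a) = 0, dot (cross a b) (polar c a b) = 0
      & dot (cross a b) (quad c b) = 0].

Lemma singular_colinear c p : p != 0 -> omega c p = 0 -> exists s, quad c p = s *: p.
Proof. exact: cross_eq0_colinear. Qed.

(** On the line through p and q, of equation l, the binary quadratic form l . P
    vanishes at every singular point, since P is proportional to the point
    there.  A third zero makes it identically zero. *)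
Lemma singular_not_collinear c p q r : no_invariant_line c ->
  omega c p = 0 -> omega c q = 0 -> omega c r = 0 ->
  cross p q != 0 -> cross p r != 0 -> cross q r != 0 -> dot (cross p q) r != 0.
Proof.
move=> nil fp fq fr pq pr qr; apply/eqP; rewrite dotC => /(orth_cross_span pq).
case=> s [t rE]; apply: (nil _ _ pq).
have zero u : u != 0 -> omega c u = 0 -> dot (cross p q) u = 0 ->
    dot (cross p q) (quad c u) = 0.
  by move=> u0 /(singular_colinear u0)[k ->] lu; rewrite dotZr lu mulr0.
have p0 : p != 0 by apply: contraNneq pq => ->; rewrite cross0l.
have q0 : q != 0 by apply: contraNneq pq => ->; rewrite cross0r.
have r0 : r != 0 by apply: contraNneq pr => ->; rewrite cross0r.
have Ep : dot (cross p q) (quad c p) = 0.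
  by apply: zero => //; rewrite dotC dot_crossl.
have Eq : dot (cross p q) (quad c q) = 0.
  by apply: zero => //; rewrite dotC dot_crossr.
split=> //; have : dot (cross p q) (quad c r) = 0.
  by apply: zero => //; rewrite rE dotDr !dotZr dotC dot_crossl dotC dot_crossr !mulr0 addr0.
rewrite rE quadDZ !dotDr !dotZr Ep Eq !mulr0 addr0 add0r => /eqP.
rewrite !mulf_eq0 => /orP[/orP[]|] /eqP // s0.
- by case/eqP: qr; rewrite rE s0 scale0r add0r crossZr crossvv scaler0.
- by case/eqP: pr; rewrite rE s0 scale0r addr0 crossZr crossvv scaler0.
Qed.

(** A univariate polynomial over a field of characteristic 0 that vanishes
    everywhere is zero, so the polynomial functions form a domain. *)
Lemma poly_fun_domain (p q : {poly K}) :
  (forall t, p.[t] * q.[t] = 0) -> p = 0 \/ q = 0.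
Proof.
move=> pq0; suff /eqP : p * q = 0.
  by rewrite mulf_eq0 => /orP[] /eqP; [left|right].
apply/eqP/negPn/negP => pq_neq0.
pose rs := [seq i%:R : K | i <- iota 0 (size (p * q))].
have : (size rs < size (p * q)%R)%N.
  apply: max_poly_roots => //; first by apply/allP => x _; rewrite /root hornerM pq0.
  by rewrite map_inj_uniq ?iota_uniq // => i j /eqP; rewrite eqr_nat => /eqP.
by rewrite size_map size_iota ltnn.
Qed.

Lemma Poly_eq0_coef (u : seq K) i : Poly u = 0 -> u`_i = 0.
Proof. by move=> u0; rewrite -coef_Poly u0 coef0. Qed.

Lemma exists_cross_neq0 a : a != 0 -> exists b, cross a b != 0.
Proof.
move=> a0; have [i ai] : exists i, a 0 i != 0 by apply/rV0Pn.
elim/I3_ind: i ai => ai.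
- exists (v3 0 1 0); apply/rV0Pn; exists iz.
  by rewrite !mxE /= mulr1 mulr0 subr0.
- exists (v3 0 0 1); apply/rV0Pn; exists ix.
  by rewrite !mxE /= mulr1 mulr0 subr0.
- exists (v3 1 0 0); apply/rV0Pn; exists iy.
  by rewrite !mxE /= mulr1 mulr0 subr0.
Qed.

(** If a . omega = 0, then P(m) lies in the plane spanned by a and m for every
    m, and every line through a is invariant. *)
Lemma omega_indep c a :
  no_invariant_line c -> (forall m, dot a (omega c m) = 0) -> a = 0.
Proof.
move=> nil a_fol; apply/eqP/negPn/negP => /exists_cross_neq0[b ab].
apply: (nil _ _ ab).
have line s : dot (cross a b) (quad c (s *: a + 1 *: b)) = 0.
  have := a_fol (s *: a + 1 *: b); rewrite {1}/omega dot_crossC dot_crossC dotC.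
  by rewrite crossDr !crossZr crossvv scaler0 add0r !scale1r.
have := line 0; have := line 1; have := line (-1).
rewrite !quadDZ !dotDr !dotZr !expr1n sqrrN expr1n !mulr1 expr0n /= !mul1r.
rewrite !mul0r !add0r mulN1r => e1 e2 e3; split=> //.
- have : 2 * dot (cross a b) (quad c a) = 0.
    move: e1 e2; rewrite e3 !addr0 => e1 e2.
    by rewrite -[0]addr0 -{1}e1 -e2; ring.
  by move/eqP; rewrite mulf_eq0 pnatr_eq0 /= => /eqP.
- have : 2 * dot (cross a b) (polar c a b) = 0.
    move: e1 e2; rewrite e3 !addr0 => e1 e2.
    by rewrite -[0]subr0 -{1}e2 -e1; ring.
  by move/eqP; rewrite mulf_eq0 pnatr_eq0 /= => /eqP.
Qed.

(** The condition a . omega(m) = 0 extends from the complement of the line to all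
    m: along m + t n, with n off the line, both factors are polynomials in t. *)
Lemma omega_indep_off_line c a l : no_invariant_line c -> l != 0 ->
  (forall m, dot m l * dot a (omega c m) = 0) -> a = 0.
Proof.
move=> nil l0 a_fol; apply: (omega_indep nil) => m.
have [n ln] := exists_dot_neq0 l0.
pose p := Poly [:: dot m l; dot n l].
pose q := Poly [:: dot a (omega c m);
  dot a (cross n (quad c m) + cross m (polar c m n));
  dot a (cross m (quad c n) + cross n (polar c m n)); dot a (omega c n)].
have [|/(@Poly_eq0_coef _ 1)|/(@Poly_eq0_coef _ 0)//] := @poly_fun_domain p q.
  move=> t; rewrite -[RHS](a_fol (m + t *: n)) !horner_Poly /=; congr (_ * _).
    by rewrite dotDl dotZl; ring.
  have -> : m + t *: n = 1 *: m + t *: n by rewrite scale1r.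
  rewrite /omega quadDZ !(crossDl, crossDr, crossZl, crossZr, dotDr, dotZr); ring.
by rewrite /= dotC => /eqP; rewrite (negbTE ln).
Qed.

Lemma dot_mulmx m l (N : 'M_3) : dot (m *m N) l = dot m (l *m N^T).
Proof. by rewrite -!dotrE trmx_mul trmxK mulmxA. Qed.

(** The Euler relation m . omega(m) = 0 is the only linear relation between the
    components of omega.  Let l be an eigenvector of the transpose of N.  The line
    l is stable under N, so on it the determinant of m, P(m) and m N is the
    product of the binary forms l . P, which is not zero, and D, whose zeros are
    the eigenvectors of N.  Hence D = 0 and N is a scalar a1 on the line.  This
    gives m N = a1 m + (m . l) v for some v, then v . omega = 0, and v = 0. *)
Lemma linear_syzygy c (N : 'M[K]_3) : no_invariant_line c ->
  (forall m, dot (m *m N) (omega c m) = 0) -> exists s, N = s%:M.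
Proof.
move=> nil syz.
have [x /eigenvalueP[l lE l0]] : exists x, eigenvalue N^T x.
  have [|x] := closed_rootP (char_poly N^T) _; last by exists x; rewrite eigenvalue_root_char.
  by rewrite size_char_poly.
have [a [b abl]] := exists_cross_basis l0.
have inplane m : dot m l = 0 -> exists s t, m *m N = s *: a + t *: b.
  move=> ml; apply: orth_cross_span; rewrite abl //.
  by rewrite dot_mulmx lE dotZr ml mulr0.
have al : dot a l = 0 by rewrite -abl dot_crossl.
have bl : dot b l = 0 by rewrite -abl dot_crossr.
have [a1 [a2 aN]] := inplane _ al; have [b1 [b2 bN]] := inplane _ bl.
pose p := Poly [:: b1; a1 - b2; - a2].
pose q := Poly [:: dot l (quad c b); dot l (polar c a b); dot l (quad c a)].
have [t|p0|q0] := @poly_fun_domain p q; last first.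
- have e := @Poly_eq0_coef _ _ q0.
  case: (nil a b); rewrite abl //; split; [exact: (e 2)|exact: (e 1)|exact: (e 0)].
- have := @Poly_eq0_coef _ 0 p0; have := @Poly_eq0_coef _ 1 p0.
  have := @Poly_eq0_coef _ 2 p0; rewrite /= => /eqP; rewrite oppr_eq0 => /eqP a20.
  move=> /subr0_eq a1b2 b10.
  exists a1; have [e le] := exists_dot_neq0 l0.
  pose v := (dot l e)^-1 *: (e *m N - a1 *: e).
  have actN m : m *m N = a1 *: m + dot m l *: v.
    pose m' := m - (dot m l / dot l e) *: e.
    have [s [t m'E]] : exists s t, m' = s *: a + t *: b.
      apply: orth_cross_span; rewrite abl // /m' -scaleNr dotDl dotZl (dotC e).
      by field.
    have m'N : m' *m N = a1 *: m'.
      rewrite m'E mulmxDl -!scalemxAl aN bN a20 b10 -a1b2 !scale0r addr0 add0r.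
      by rewrite scalerDr !scalerA ![_ * a1]mulrC.
    rewrite -{1}[m](subrK ((dot m l / dot l e) *: e)) -/m' mulmxDl m'N.
    rewrite -scalemxAl /v scalerA /m'; move: (e *m N) (_ / _) => eN k; vec.
  have v0 : v = 0.
    apply: (omega_indep_off_line nil l0) => m.
    by have := syz m; rewrite actN dotDl !dotZl dot_omega mulr0 add0r.
  apply/row_matrixP => i; rewrite !rowE actN v0 scaler0 addr0.
  by rewrite mul_mx_scalar.
- rewrite -[RHS](syz (t *: a + 1 *: b)) !horner_Poly /=.
  rewrite /omega dot_crossC dot_crossC dotC mulmxDl -!scalemxAl aN bN.
  rewrite quadDZ -abl.
  rewrite !(crossDl, crossDr, crossZl, crossZr, dotDl, dotZl, dotDr, dotZr, crossvv, dot0l).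
  rewrite [cross b a]crossC -scaleN1r.
  rewrite !(dotC (cross a b)) !dotZr !dot0r; ring.
Qed.
End NoInvariantLine.

(** * Cubics through seven singular points *)

Section Cubics.
Variable K : fieldType.
Implicit Types (a b m v : 'rV[K]_3) (f g : {mpoly K[3]}).

Definition lform v : {mpoly K[3]} :=
  v 0 ix *: 'X_ix + v 0 iy *: 'X_iy + v 0 iz *: 'X_iz.

Lemma lform_homog v : lform v \is 1.-homog.
Proof. by rewrite !rpredD // rpredZ // dhomogX /= mdeg1. Qed.

Lemma lformE v m : (lform v).@[m 0] = dot v m.
Proof. by rewrite !mevalD !mevalZ !mevalXU. Qed.

(** Evaluation at the seven points maps the cubics, a space of dimension 10,
    onto K^7, because of the cubics that separate each point from the others.
    The kernel has dimension 3. *)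
Lemma cubics_through_span (p : 'I_7 -> 'rV[K]_3) (X : 3.-tuple (dhomog 3 K 3)) :
  free X ->
  (forall i, exists g : dhomog 3 K 3, (val g).@[p i 0] != 0 /\
     forall j, j != i -> (val g).@[p j 0] = 0) ->
  (forall k i, (val (tnth X k)).@[p i 0] = 0) ->
  forall f : dhomog 3 K 3, (forall i, (val f).@[p i 0] = 0) -> f \in <<X>>%VS.
Proof.
move=> freeX sep Xp f fp.
pose e (g : dhomog 3 K 3) : 'rV[K]_7 := \row_i (val g).@[p i 0].
have e_lin : linear e.
  by move=> k g h; apply/rowP => i; rewrite !mxE /= mevalD mevalZ.
pose eL := GRing.isLinear.Build _ _ _ _ e e_lin.
pose E : {linear dhomog 3 K 3 -> 'rV[K]_7} := HB.pack e eL.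
pose ev := linfun E.
have evE (g : dhomog 3 K 3) : ev g = e g by rewrite lfunE.
have full : (ev @: fullv)%VS = fullv.
  apply/eqP; rewrite eqEsubv subvf /=; apply/subvP => r _.
  rewrite [r]row_sum_delta; apply: memv_suml => i _; apply: memvZ.
  have [g [gi gj]] := sep i; apply/memv_imgP.
  exists (((val g).@[p i 0])^-1 *: g); rewrite ?memvf // linearZ /= evE.
  apply/rowP => j; rewrite !mxE eqxx /=.
  by have [->|ji] := eqVneq j i; [rewrite mulVf|rewrite (gj _ ji) mulr0].
have := limg_ker_dim ev fullv; rewrite full capfv !dimvf /= /dim /= => dims.
have XE : <<X>>%VS = lker ev.
  apply/eqP; rewrite eqEdim; apply/andP; split.
    apply/span_subvP => _ /tnthP[k ->]; rewrite memv_ker evE.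
    by apply/eqP/rowP => i; rewrite !mxE Xp.
  by rewrite (eqP freeX) size_tuple -(leq_add2r (1 * 7)) dims.
rewrite XE memv_ker evE; by apply/eqP/rowP => i; rewrite !mxE fp.
Qed.
End Cubics.

Section SevenSingularPoints.
Variable K : numClosedFieldType.
Variables (F : 'I_3 -> {mpoly K[3]}) (c : nat -> nat -> K).
Hypothesis F_homog : forall i, F i \is 3.-homog.
Hypothesis FE : forall m, eval_forms F m = omega c m.
Hypothesis nil : no_invariant_line c.
Implicit Types (f g : {mpoly K[3]}) (p : 'I_7 -> 'rV[K]_3) (q m : 'rV[K]_3).

(** Singular points outside the family [p] are not excluded here; their absence is
    [singular_in_config]. *)
Definition singular_config p :=
  (forall i, omega c (p i) = 0) /\ (forall i j, i != j -> cross (p i) (p j) != 0).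

Definition combination (a : 'rV[K]_3) : {mpoly K[3]} := \sum_i a 0 i *: F i.

Lemma FiE i m : (F i).@[m 0] = omega c m 0 i.
Proof. by rewrite -FE mxE. Qed.

Lemma combinationE a m : (combination a).@[m 0] = dot a (omega c m).
Proof. by rewrite /combination sum3 !mevalD !mevalZ !FiE. Qed.

Lemma config_not_collinear p i j k : singular_config p ->
  i != j -> i != k -> j != k -> dot (cross (p i) (p j)) (p k) != 0.
Proof. by case=> p0 pp ij ik jk; apply: (singular_not_collinear nil); auto. Qed.

(** Three lines, each through two of the six other points, form a cubic that
    separates p_i from them. *)
Lemma cubic_through_span p f : singular_config p -> cubic_through p f ->
  exists a, f = combination a.
Proof.
move=> sp [fh fp].
pose X := [tuple DHomog (F_homog i) | i < 3].
have XE i : val (tnth X i) = F i by rewrite tnth_mktuple.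
have freeX : free X.
  apply/freeP => k /(congr1 val); rewrite raddf_sum /= => k0.
  suff a0 : \row_i k i = 0 by move=> i; have /rowP/(_ i) := a0; rewrite !mxE.
  apply: (omega_indep nil) => m; rewrite -combinationE -[RHS](meval0 (m 0)) -k0.
  congr (_.@[_]); apply: eq_bigr => i _.
  by rewrite mxE (nth_map i) ?size_enum_ord // nth_ord_enum.
have sep i : exists g : dhomog 3 K 3, (val g).@[p i 0] != 0 /\
    forall j, j != i -> (val g).@[p j 0] = 0.
  pose l a b := lform (cross (p (lift i (inord a))) (p (lift i (inord b)))).
  have lh a b : l a b \is 1.-homog by apply: lform_homog.
  have gh : l 0%N 1%N * l 2%N 3%N * l 4%N 5%N \is 3.-homog.
    exact: (dhomogM (dhomogM (lh _ _) (lh _ _)) (lh _ _)).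
  have li a b : (a < 6)%N -> (b < 6)%N -> a != b -> (l a b).@[p i 0] != 0.
    move=> a6 b6 ab; rewrite lformE config_not_collinear // 1?eq_sym ?neq_lift //.
    by rewrite (inj_eq lift_inj) -val_eqE /= !inordK // eq_sym.
  exists (DHomog gh); split => [|j].
    by rewrite /= !mevalM !mulf_neq0 ?li.
  rewrite eq_sym => /unlift_some[k -> _] /=; rewrite !mevalM !lformE.
  have -> : k = inord (val k) by rewrite inord_val.
  by case: k => [[|[|[|[|[|[|//]]]]]] k6] /=;
    rewrite ?(dotC (cross _ _)) ?dot_crossl ?dot_crossr ?(mul0r, mulr0).
have /coord_span : DHomog fh \in <<X>>%VS.
  by apply: (cubics_through_span freeX sep) => // k i; rewrite XE FiE (proj1 sp) mxE.
move=> /(congr1 val); rewrite raddf_sum /= => fE.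
exists (\row_i coord X i (DHomog fh)); rewrite {1}fE; apply: eq_bigr => i _.
by rewrite mxE /= (nth_map i) ?size_enum_ord // nth_ord_enum.
Qed.

(** If f is a conic through six of the points, its product with any line through
    the seventh one is a cubic through all seven.  Two such lines b1 and b2 give
    f b1 = a1 . omega and f b2 = a2 . omega, hence the linear relation
    (b1 a2 - b2 a1) . omega = 0.  It is a multiple of the Euler relation, and a
    trivial one since b1 and b2 vanish at the seventh point; so a1 = 0, and
    f b1 = 0. *)
Lemma six_not_on_conic p f i6 : singular_config p -> f \is 2.-homog ->
  (forall j, j != i6 -> f.@[p j 0] = 0) -> f = 0.
Proof.
move=> sp fh fp; apply/eqP/negPn/negP => f0.
have p0 : p i6 != 0.
  have [j] : exists j, i6 != j.
    by exists (lift i6 ord0); rewrite neq_lift.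
  by move=> /(proj2 sp); apply: contraNneq => ->; rewrite cross0l.
have [b1 [b2 bE]] := exists_cross_basis p0.
have span b : dot b (p i6) = 0 -> exists a, f * lform b = combination a.
  move=> bp; apply: (cubic_through_span sp); split=> [|j].
    exact: (dhomogM fh (lform_homog _)).
  rewrite mevalM lformE; have [->|/fp->] := eqVneq j i6; last by rewrite mul0r.
  by rewrite bp mulr0.
have [a1 fb1] := span b1 ltac:(by rewrite -bE dot_crossl).
have [a2 fb2] := span b2 ltac:(by rewrite -bE dot_crossr).
have valE b a m : f * lform b = combination a ->
    dot a (omega c m) = f.@[m 0] * dot b m.
  by move=> fb; rewrite -combinationE -fb mevalM lformE.
pose N := b1^T *m a2 - b2^T *m a1.
have NE m : m *m N = dot m b1 *: a2 - dot m b2 *: a1.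
  have E b a : m *m (b^T *m a) = dot m b *: a.
    by rewrite mulmxA [m *m _]mx11_scalar dotrE mul_scalar_mx.
  by rewrite mulmxBr !E.
have [|s Ns] := @linear_syzygy _ c N nil.
  move=> m; rewrite NE -scaleNr dotDl !dotZl (valE _ _ m fb1) (valE _ _ m fb2).
  by rewrite !(dotC m); ring.
have s0 : s = 0.
  have := NE (p i6); rewrite Ns mul_mx_scalar -bE.
  rewrite ![dot (cross _ _) _]dotC dot_crossl dot_crossr !scale0r subr0 bE.
  by move=> /eqP; rewrite scaler_eq0 (negbTE p0) orbF => /eqP.
have [w pw] := exists_dot_neq0 p0.
have /eqP := NE (cross b1 w).
rewrite Ns s0 mul_mx_scalar scale0r [dot _ b1]dotC dot_crossl scale0r sub0r.
rewrite eq_sym oppr_eq0 scaler_eq0 => /orP[/eqP b2w|/eqP a10].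
  by case/eqP: pw; rewrite -bE -[RHS]oppr0 -b2w; sca.
move: fb1; rewrite a10 /combination big1 => [|i _]; last by rewrite mxE scale0r.
move/eqP; rewrite mulf_eq0 (negbTE f0) /= => /eqP b10.
have [w1 b1w] : exists w, dot b1 w != 0.
  by apply: exists_dot_neq0; apply: contraNneq p0 => b1_0; rewrite -bE b1_0 cross0l.
by rewrite -lformE b10 meval0 eqxx in b1w.
Qed.

(** Let q be another singular point.  The conic through the first five points
    and the line through the last two form a cubic through all seven, hence a
    combination of the components of omega, and it vanishes at q.  As q is not on
    the line, six singular points lie on the conic. *)
Lemma singular_in_config p q : singular_config p -> q != 0 -> omega c q = 0 ->
  exists i, cross q (p i) == 0.
Proof.
move=> sp q0 fq; apply/existsP; apply: contraT => /existsPn qp.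
pose P k := p (inord k : 'I_7); pose l a b := lform (cross (P a) (P b)).
have nc a b d : (a < 7)%N -> (b < 7)%N -> (d < 7)%N -> a != b -> a != d ->
    b != d -> dot (cross (P a) (P b)) (P d) != 0.
  move=> a7 b7 d7 ab ad bd; apply: config_not_collinear => //;
    by rewrite -val_eqE /= !inordK.
have fP a : omega c (P a) = 0 by case: sp => fp _; apply: fp.
have PP a b : (a < 7)%N -> (b < 7)%N -> a != b -> cross (P a) (P b) != 0.
  by move=> a7 b7 ab; case: sp => _; apply; rewrite -val_eqE /= !inordK.
have Pq a : cross (P a) q != 0 by rewrite crossC oppr_eq0; apply: qp.
have lh a b : l a b \is 1.-homog by apply: lform_homog.
pose k a b := (l a b).@[P 4%N 0].
(* The conic through [P 0], ..., [P 4], in the pencil spanned by two pairs of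
   lines through the first four points. *)
pose f := (k 0%N 2%N * k 1%N 3%N) *: (l 0%N 1%N * l 2%N 3%N)
  - (k 0%N 1%N * k 2%N 3%N) *: (l 0%N 2%N * l 1%N 3%N).
have fh : f \is 2.-homog.
  by rewrite rpredB ?rpredZ //; apply: (dhomogM (lh _ _) (lh _ _)).
have fE m : f.@[m 0] =
    k 0%N 2%N * k 1%N 3%N *
      (dot (cross (P 0%N) (P 1%N)) m * dot (cross (P 2%N) (P 3%N)) m)
    - k 0%N 1%N * k 2%N 3%N *
      (dot (cross (P 0%N) (P 2%N)) m * dot (cross (P 1%N) (P 3%N)) m).
  by rewrite mevalB !mevalZ !mevalM !lformE.
have f5 a : (a < 5)%N -> f.@[P a 0] = 0.
  rewrite fE /k !lformE; case: a => [|[|[|[|[|//]]]]] _;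
  rewrite ?(dotC (cross _ _) (P _)) ?dot_crossl ?dot_crossr; ring.
have f0 : f != 0.
  (* At [P 0 + P 1] only the second pair of lines contributes. *)
  apply/eqP => f0; have := fE (P 0%N + P 1%N).
  rewrite f0 meval0 !dotDr ![dot (cross (P 0%N) _) (P 0%N)]dotC !dot_crossl.
  rewrite ![dot _ (P 1%N)]dotC dot_crossr dot_crossl addr0 mul0r mulr0 sub0r add0r addr0.
  move/esym/eqP; rewrite oppr_eq0 /k !lformE; apply/negP.
  by rewrite !mulf_neq0 // ?(dotC (P 1%N)) nc.
have [a fa] : exists a, f * l 5%N 6%N = combination a.
  apply: (cubic_through_span sp); split=> [|i]; first exact: (dhomogM fh (lh _ _)).
  rewrite mevalM; have -> : p i = P i by rewrite /P inord_val.
  have := ltn_ord i; rewrite ltnS leq_eqVlt => /orP[/eqP->|].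
    by rewrite lformE dotC dot_crossr mulr0.
  rewrite ltnS leq_eqVlt => /orP[/eqP->|/f5->]; last by rewrite mul0r.
  by rewrite lformE dotC dot_crossl mulr0.
have fq0 : f.@[q 0] = 0.
  have := combinationE a q; rewrite -fa fq dot0r mevalM lformE => /eqP.
  rewrite mulf_eq0 => /orP[/eqP //|]; apply: contraTeq => _.
  have P56 := PP 5%N 6%N isT isT isT.
  exact: (singular_not_collinear nil (fP 5%N) (fP 6%N) fq P56 (Pq _) (Pq _)).
pose p' i := if i == inord 5 :> 'I_7 then q else p i.
suff sp' : singular_config p'.
  case/eqP: f0; apply: (six_not_on_conic (i6 := inord 6) sp' fh) => j j6.
  rewrite /p'; have [//|j5] := eqVneq j (inord 5).
  have -> : p j = P j by rewrite /P inord_val.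
  apply: f5; move: j6 j5; rewrite -!val_eqE /= !inordK // => j6 j5.
  by have := ltn_ord j; rewrite ltnS leq_eqVlt (negbTE j6) ltnS leq_eqVlt (negbTE j5).
split=> [i|i j ij]; rewrite /p'; first by case: ifP => // _; case: sp.
have [iE|i5] := eqVneq i (inord 5); have [jE|j5] := eqVneq j (inord 5) => //.
- by rewrite iE jE eqxx in ij.
- by rewrite crossC oppr_eq0.
- by case: sp => _; apply.
Qed.
End SevenSingularPoints.

(** * The associated involution and base points of the net of cubics *)

Section GeiserOfAssociated.
Variable K : numClosedFieldType.
Variables (F : 'I_3 -> {mpoly K[3]}) (c : nat -> nat -> K).
Hypothesis F_homog : forall i, F i \is 3.-homog.
Hypothesis FE : forall m, eval_forms F m = omega c m.
Hypothesis nil : no_invariant_line c.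
Implicit Types (f g : {mpoly K[3]}) (p : 'I_7 -> 'rV[K]_3) (q m : 'rV[K]_3).

Lemma homog1_lform f : f \is 1.-homog -> exists v, f = lform v.
Proof.
move=> fh; exists (v3 f@_U_(ix) f@_U_(iy) f@_U_(iz)).
apply/mpolyP => e; have [/eqP|e1] := eqVneq (mdeg e) 1%N; last first.
  by rewrite (dhomog_nemf_coeff fh e1) (dhomog_nemf_coeff (lform_homog _) e1).
rewrite mdeg_eq1 => /existsP[i /eqP ->].
rewrite /lform !mcoeffD !mcoeffZ !mcoeffXU /v3 !mxE /=.
by elim/I3_ind: i; rewrite /= !(mulr0, mulr1, addr0, add0r).
Qed.

Lemma config_neq0 p i : singular_config c p -> p i != 0.
Proof.
case=> _ /(_ _ _ (neq_lift i ord0)); apply: contraNneq => ->.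
by rewrite cross0l.
Qed.

Lemma config_general_position p : singular_config c p -> general_position p.
Proof.
move=> sp; split=> [i|i j ij|A A3|A A6].
- exact: config_neq0.
- by rewrite eqmx_cross ?config_neq0 //; case: sp => _; apply.
- have /card_gt2P[i [j [k [[iA jA kA] [ij jk ki]]]]] : (2 < #|A|)%N by rewrite A3.
  case=> f [f0 /homog1_lform[v fE] fA].
  have vA x : x \in A -> dot v (p x) = 0 by move=> /fA; rewrite fE lformE.
  have ik : i != k by rewrite eq_sym.
  have ijk := config_not_collinear nil sp ij ik jk.
  have pij : cross (p i) (p j) != 0 by case: sp => _; apply.
  have := cross_orth (vA i iA) (vA j jA) => /cross_eq0_sym.
  move=> /(cross_eq0_colinear pij)[s vE].
  have := vA k kA; rewrite vE dotZl => /eqP.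
  rewrite mulf_eq0 (negbTE ijk) orbF => /eqP s0.
  by case/eqP: f0; rewrite fE vE s0 scale0r /lform !mxE !scale0r !addr0.
- have /cards1P[i6 iE] : #|~: A| == 1%N.
    by rewrite -(eqn_add2l #|A|) cardsC A6 card_ord.
  case=> f [/eqP f0 fh fA]; apply: f0.
  apply: (six_not_on_conic F_homog FE nil (i6 := i6) sp fh) => j ji.
  by apply: fA; have := in_set1 j i6; rewrite -iE inE (negbTE ji) => /negbFE.
Qed.

Lemma tangent_atP m q : omega c m != 0 -> m != 0 ->
  tangent_at F (tangent_line F m) q <->
  [/\ q != 0, omega c q != 0 & cross (omega c q) (omega c m) = 0].
Proof.
move=> fm m0; rewrite /tangent_at /regular_point /tangent_line !FE; split.
  by case=> -[q0 fq]; rewrite eqmx_kermx_rowP // => /eqP.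
by case=> q0 fq fqm; split=> //; rewrite eqmx_kermx_rowP // fqm eqxx.
Qed.

(** The cubics through the points of [p] and m are the a . omega with a orthogonal
    to omega(m), and their common zeros are the q such that omega(q) is zero or
    proportional to omega(m). *)
Lemma base_point_singular p m q : singular_config c p -> omega c m != 0 ->
  base_point p m q <-> q != 0 /\ cross (omega c q) (omega c m) = 0.
Proof.
move=> sp fm; split=> -[q0 H]; split=> //; last first.
  move=> f /(cubic_through_span F_homog FE nil sp)[a ->].
  rewrite !(combinationE FE); have [s ->] := cross_eq0_colinear fm (cross_eq0_sym H).
  by rewrite dotZr => ->; rewrite mulr0.
apply: dot_eq0 => b.
have := H (combination F (cross (omega c m) b)).
rewrite !(combinationE FE) => bq.
rewrite -[RHS]bq.
- by move: (omega c q) (omega c m) => u v; sca.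
- split=> [|i]; first by apply: rpred_sum => i _; apply: rpredZ; apply: F_homog.
  by rewrite (combinationE FE) (proj1 sp) dot0r.
- by rewrite dotC dot_crossl.
Qed.

(** A base point that is not singular is tangent to the tangent line of m, hence
    is m or its image. *)
Lemma associated_geiser p phi : singular_config c p ->
  associated_involution F phi -> geiser_involution phi.
Proof.
move=> sp [bir [U [Uopen Uex Uassoc]]]; split=> //.
exists p; first exact: config_general_position.
exists U; split=> // m m0 Um.
have [[[_ fm] _] mm' m'm uniq] := Uassoc m m0 Um.
set m' := eval_forms phi m in mm' m'm uniq *.
rewrite FE in fm.
have /(tangent_atP _ fm m0)[m'0 fm' fmm'] := mm'.
have not_sing x i : x != 0 -> omega c x != 0 -> ~~ (x == p i)%MS.
  have p0 := config_neq0 i sp.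
  move=> x0; apply: contraNN; rewrite eqmx_cross // => /eqP xp.
  have [s xE] := cross_eq0_colinear p0 (cross_eq0_sym xp).
  by rewrite xE omegaZ (proj1 sp) scaler0.
split=> // [i|q]; first by split; apply: not_sing.
rewrite (base_point_singular _ sp fm); split=> -[q0 H]; split=> //.
  have [fq|fq] := eqVneq (omega c q) 0.
    have [i qi] := singular_in_config F_homog FE nil sp q0 fq.
    by apply: Or31; exists i; rewrite eqmx_cross ?(config_neq0 i sp).
  have [|qm|qm] := uniq q; [|exact: Or32|exact: Or33].
    by apply/tangent_atP.
have same x : x != 0 -> (q == x)%MS -> exists s, omega c q = s *: omega c x.
  move=> x0; rewrite eqmx_cross // => /eqP/cross_eq0_sym.
  by move=> /(cross_eq0_colinear x0)[s ->]; rewrite omegaZ; eexists.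
case: H => [[i /(same _ (config_neq0 i sp))]|/(same _ m0)|/(same _ m'0)] [s ->].
- by rewrite (proj1 sp) scaler0 cross0l.
- by rewrite crossZl crossvv scaler0.
- by rewrite crossZl fmm' scaler0.
Qed.
End GeiserOfAssociated.

(** * Sylvester matrices of prescribed shape *)

Section Sylvester.

Definition syl_row (A : pzRingType) (p : nat -> A) (i j : nat) : A :=
  if (j < i)%N then 0 else p (j - i)%N.

(** The shape is prescribed instead of being read off the degrees of [p] and [q],
    so that the determinant is a form when the coefficients vary. *)
Definition syl (A : pzRingType) m n (p q : nat -> A) : 'M[A]_(n + m) :=
  col_mx (\matrix_(i, j) syl_row p i j) (\matrix_(i, j) syl_row q i j).

Lemma map_syl (A B : pzRingType) (f : {rmorphism A -> B}) m n p q :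
  map_mx f (syl m n p q) = syl m n (f \o p) (f \o q).
Proof.
rewrite /syl map_col_mx; congr col_mx; apply/matrixP => i j;
  by rewrite !mxE /syl_row; case: ifP => //; rewrite rmorph0.
Qed.

Lemma syl_row_horner (A : comNzRingType) (p : {poly A}) y i N : (size p + i <= N)%N ->
  \sum_(j < N) syl_row (fun k => p`_k) i j * y ^+ j = y ^+ i * p.[y].
Proof.
move=> sp; have -> : y ^+ i * p.[y] = ('X^i * p).[y] by rewrite hornerM hornerXn.
rewrite (@horner_coef_wide _ N); last first.
  rewrite (leq_trans (size_polyMleq _ _)) // size_polyXn addSn /=.
  by rewrite addnC.
by apply: eq_bigr => j _; rewrite coefXnM.
Qed.

(** The powers of a common root form a vector of the kernel. *)
Lemma det_syl_root (K : fieldType) m n (p q : {poly K}) y :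
  (size p <= m.+1)%N -> (size q <= n.+1)%N -> (0 < n + m)%N ->
  root p y -> root q y -> \det (syl m n (fun k => p`_k) (fun k => q`_k)) = 0.
Proof.
move=> sp sq nm /rootP py /rootP qy; rewrite -det_tr; apply/eqP/det0P.
exists (\row_j y ^+ j).
  by apply/rV0Pn; exists (Ordinal nm); rewrite mxE /= oner_eq0.
apply: trmx_inj; rewrite trmx_mul trmxK trmx0 mul_col_mx.
have row0 (r : {poly K}) k : r.[y] = 0 -> (size r + k <= (n + m).+1)%N ->
    \matrix_(i < k, j < n + m) syl_row (fun l => r`_l) i j *m (\row_j y ^+ j)^T = 0.
  move=> ry sr; apply/colP => i; rewrite !mxE.
  under eq_bigr do rewrite !mxE.
  rewrite syl_row_horner ?ry ?mulr0 //; have ik := ltn_ord i.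
  by clear -sr ik; move: (size r) (nat_of_ord i) sr ik => x z sr ik; lia.
by rewrite !row0 ?col_mx0 //; move: (size p) (size q) sp sq => *; lia.
Qed.

Lemma syl_row_rVpoly (A : comNzRingType) k N (u : 'rV[A]_k) (p : {poly A}) (j : 'I_N) :
  (u *m \matrix_(i, j) syl_row (fun l => p`_l) i j) 0 j = (rVpoly u * p)`_j.
Proof.
rewrite mxE /rVpoly poly_def mulr_suml coef_sum; apply: eq_bigr => i _.
by rewrite mxE -scalerAl coefZ coefXnM valK.
Qed.

(** A vector of the kernel is a relation a p + b q = 0 with a and b too small for
    coprime p and q.  One of [p], [q] must have the prescribed degree, for otherwise
    the determinant vanishes because of a common root at infinity. *)
Lemma det_syl0P (K : fieldType) m n (p q : {poly K}) :
  (size p <= m.+1)%N -> (size q <= n.+1)%N ->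
  \det (syl m n (fun k => p`_k) (fun k => q`_k)) = 0 ->
  size p = m.+1 \/ size q = n.+1 -> ~~ coprimep p q.
Proof.
move=> sp sq /eqP/det0P[w w0 wS] spq; apply/negP => copq.
pose a := rVpoly (lsubmx w); pose b := rVpoly (rsubmx w).
have sa : (size a <= n)%N by apply: size_poly.
have sb : (size b <= m)%N by apply: size_poly.
have ab0 : a * p + b * q = 0.
  apply/polyP => j; rewrite coef0; have [jnm|nmj] := ltnP j (n + m).
    have /rowP/(_ (Ordinal jnm)) := wS.
    rewrite -{1}[w]hsubmxK mul_row_col mxE !syl_row_rVpoly !mxE coefD; exact.
  rewrite nth_default // (leq_trans (size_polyD _ _)) // geq_max.
  have := size_polyMleq a p; have := size_polyMleq b q.
  move: (size (a * p)) (size (b * q)) (size a) (size b) (size p) (size q) sa sb sp sq nmj.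
  by move=> *; lia.
have {}ab0 : a = 0 /\ b = 0.
  case: spq => [sp'|sq'].
  - have p0 : p != 0 by rewrite -size_poly_gt0 sp'.
    have : p %| b.
      rewrite -(Gauss_dvdpl _ copq); apply/dvdpP; exists (- a).
      by apply/eqP; rewrite mulNr -addr_eq0 addrC ab0.
    move=> /dvdp_leq; rewrite sp'; have [b0 _|b0 /(_ isT)] := eqVneq b 0; last first.
      by rewrite leqNgt ltnS sb.
    split=> //; move/eqP: ab0; rewrite b0 mul0r addr0 mulf_eq0 (negbTE p0) orbF.
    by move/eqP.
  - have q0 : q != 0 by rewrite -size_poly_gt0 sq'.
    have : q %| a.
      have copqp : coprimep q p by rewrite coprimep_sym.
      rewrite -(Gauss_dvdpl _ copqp).
      by apply/dvdpP; exists (- b); apply/eqP; rewrite mulNr -addr_eq0 ab0.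
    move=> /dvdp_leq; rewrite sq'; have [a0 _|a0 /(_ isT)] := eqVneq a 0; last first.
      by rewrite leqNgt ltnS sa.
    split=> //; move/eqP: ab0; rewrite a0 mul0r add0r mulf_eq0 (negbTE q0) orbF.
    by move/eqP.
case/eqP: w0; rewrite -[w]hsubmxK.
have rV0 k (u : 'rV[K]_k) : rVpoly u = 0 -> u = 0.
  by move=> u0; rewrite -[u]rVpolyK u0 linear0.
by rewrite (rV0 _ _ (proj1 ab0)) (rV0 _ _ (proj2 ab0)) row_mx0.
Qed.

(** When the entry (i, j) has degree at most r_i - j, every term of the expansion
    of the determinant has degree at most the sum of the r_i minus that of the j. *)
Lemma det_size (K : fieldType) N (M : 'M[{poly K}]_N) (r : 'I_N -> nat) d :
  (forall i j, M i j != 0 -> (size (M i j) + j <= (r i).+1)%N) ->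
  (\sum_i r i = d + \sum_(j < N) j)%N -> (size (\det M)%R <= d.+1)%N.
Proof.
move=> Mr rd; rewrite (leq_trans (size_sum _ _ _)) //; apply/bigmax_leqP => s _.
rewrite -signr_odd mulr_sign; case: ifP => _; rewrite ?size_polyN;
have [/existsP[i /eqP Mi]|/existsPn M0] := boolP [exists i, M i (s i) == 0].
1,3: by rewrite (bigD1 i) //= Mi mul0r size_poly0.
all: rewrite (leq_trans (size_prod_leq _ _)) //.
all: have : (\sum_i (size (M i (s i)) + s i) <= \sum_i (r i).+1)%N
  by apply: leq_sum => i _; apply: Mr.
all: rewrite big_split /=.
all: have <- : (\sum_(j < N) j = \sum_i s i)%N by rewrite (reindex_inj (@perm_inj _ s)).
all: under [X in (_ <= X)%N -> _]eq_bigr do rewrite -addn1.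
all: rewrite big_split /= rd sum_nat_const muln1 /=.
all: rewrite addnAC leq_add2r; set x := (\sum_i size _)%N; lia.
Qed.
End Sylvester.

(** * The eliminant of the singular points *)

Section Eliminant.
Variable K : numClosedFieldType.
Implicit Types (c : nat -> nat -> K) (t y : K).

(** Let P = (A, B, C).  For x = t and z = 1 the point is singular iff A - t C and
    y C - B vanish.  The tables list the coefficients of these two polynomials and
    of y A - t B = t (y C - B) + y (A - t C), by powers of y and then of t. *)
Definition htab c : seq (seq K) :=
  [:: [:: c%(0,2); c%(0,4); - c%(2,3); - c%(2,0)];
      [:: c%(0,1); c%(0,3) - c%(2,4); - c%(2,1)];
      [:: c%(0,0); - c%(2,2)]].

Definition ktab c : seq (seq K) :=
  [:: [:: - c%(1,0); - c%(1,1); - c%(1,2)];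
      [:: - c%(1,3); c%(2,3) - c%(1,4); c%(2,0)];
      [:: c%(2,4); c%(2,1)];
      [:: c%(2,2)]].

Definition wtab c : seq (seq K) :=
  [:: [:: 0; - c%(1,0); - c%(1,1); - c%(1,2)];
      [:: c%(0,2); c%(0,4) - c%(1,3); - c%(1,4)];
      [:: c%(0,1); c%(0,3)];
      [:: c%(0,0)]].

Definition tabpoly (tab : seq (seq K)) k : {poly K} := Poly (nth [::] tab k).

Definition chi c : {poly K} :=
  \det (syl 2 3 (tabpoly (htab c)) (tabpoly (ktab c))).

Lemma wtabE c k : tabpoly (wtab c) k =
  'X * tabpoly (ktab c) k + (if k is k'.+1 then tabpoly (htab c) k' else 0).
Proof.
have tabE tab n i : (tabpoly tab n)`_i = (nth [::] tab n)`_i by rewrite coef_Poly.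
apply/polyP => i; rewrite coefD coefXM.
by case: k i => [|[|[|[|k]]]] [|[|[|[|i]]]]; rewrite !tabE ?coef0 /= ?nth_nil; ring.
Qed.

(** Row operations turn the rows of y C - B, once multiplied by t, into those of
    y A - t B. *)
Lemma det_wtab c :
  \det (syl 2 3 (tabpoly (htab c)) (tabpoly (wtab c))) = 'X^2 * chi c.
Proof.
pose E : 'M[{poly K}]_(2, 3) := \matrix_(i, j) ((j : nat) == i.+1)%:R.
rewrite /chi; set S := syl _ _ _ (tabpoly (ktab c)).
have -> : syl 2 3 (tabpoly (htab c)) (tabpoly (wtab c)) =
    block_mx 1%:M 0 E 'X%:M *m S.
  rewrite /S /syl mul_block_col mul1mx mul0mx addr0 mul_scalar_mx.
  congr col_mx; apply/matrixP => i j; rewrite !mxE.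
  rewrite (bigD1 (lift ord0 i)) //= big1 => [|l li]; last first.
    by rewrite mxE -[_ == _.+1]/(l == lift ord0 i) (negbTE li) mul0r.
  rewrite !mxE /= eqxx mul1r addr0 /syl_row /bump /= add1n.
  have [ji|ij|ji] := ltngtP j i.
  - by rewrite (leqW ji) mulr0 addr0.
  - by rewrite ltnNge ij /= wtabE subnS -(ltn_predK (_ : 0 < j - i)%N) ?subn_gt0 // addrC.
  - by rewrite ji ltnSn subnn wtabE addr0 add0r.
by rewrite det_mulmx det_lblock det1 det_scalar mul1r.
Qed.

Lemma size_tab (tab : seq (seq K)) k :
  all (fun k => size (nth [::] tab k) + k <= 4)%N (iota 0 (size tab)) ->
  tabpoly tab k != 0 -> (size (tabpoly tab k) + k <= 4)%N.
Proof.
move=> /allP tab4 k0; have [kt|tk] := ltnP k (size tab); last first.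
  by rewrite /tabpoly nth_default // eqxx in k0.
rewrite (leq_trans _ (tab4 k _)) ?mem_iota // leq_add2r; exact: size_Poly.
Qed.

(** The degrees of the coefficients in t give the bound 9 for the determinant of
    [det_wtab], which is t^2 times the eliminant. *)
Lemma size_chi c : (size (chi c) <= 8)%N.
Proof.
have [->|chi0] := eqVneq (chi c) 0; first by rewrite size_poly0.
suff : (size ('X^2 * chi c)%R <= 10)%N by rewrite size_monicM ?monicXn // size_polyXn.
rewrite -det_wtab.
apply: (@det_size _ _ _ (fun i => if (i < 3)%N then i + 3 else i)%N); last first.
  by rewrite !big_ord_recl !big_ord0.
have row tab (i j : nat) :
    all (fun k => size (nth [::] tab k) + k <= 4)%N (iota 0 (size tab)) ->
    syl_row (tabpoly tab) i j != 0 -> (size (syl_row (tabpoly tab) i j) + j <= i + 4)%N.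
  rewrite /syl_row => tab4; case: ltnP => [_|ij /(size_tab tab4)]; first by rewrite eqxx.
  move: (size _) => s; lia.
move=> i j; rewrite /syl mxE; case: splitP => k ik; rewrite mxE => Mij.
  by move: (row (htab c) _ _ isT Mij); rewrite ik (addnS k 3).
by move: (row (wtab c) _ _ isT Mij); rewrite ik (addnC 3 k) (addnS k 3).
Qed.

Definition h_at c t : {poly K} := Poly [seq (Poly s).[t] | s <- htab c].
Definition k_at c t : {poly K} := Poly [seq (Poly s).[t] | s <- ktab c].

Lemma chiE c t :
  (chi c).[t] = \det (syl 2 3 (fun k => (h_at c t)`_k) (fun k => (k_at c t)`_k)).
Proof.
rewrite -[LHS]/(horner_eval t _) -det_map_mx map_syl; congr (\det _).
have tabE tab k : (Poly [seq (Poly s).[t] | s <- tab])`_k = (tabpoly tab k).[t].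
  rewrite coef_Poly /tabpoly; have [kt|tk] := ltnP k (size tab).
    by rewrite (nth_map [::]).
  by rewrite !nth_default ?size_map // horner0.
by congr col_mx; apply/matrixP => i j; rewrite !mxE /syl_row; case: ifP => // _;
  rewrite tabE.
Qed.

Lemma omega_chart c t y :
  omega c (v3 t y 1) =
  v3 (k_at c t).[y] (h_at c t).[y] (- y * (h_at c t).[y] - t * (k_at c t).[y]).
Proof.
rewrite /omega /quad; apply: row3P; rewrite /cross /v3 !mxE !horner_Poly /=;
  rewrite !horner_cons !hornerC; ring.
Qed.

(** The point (0 : 1 : 0) is not singular when [c 0 0] is not zero; this excludes
    that the common root in y be at infinity. *)
Lemma chi_root_singular c t : c%(0,0) != 0 -> root (chi c) t ->
  exists y, omega c (v3 t y 1) = 0.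
Proof.
move=> a0 /rootP; rewrite chiE => /det_syl0P.
have sh : (size (h_at c t) <= 3)%N by apply: size_Poly.
have sk : (size (k_at c t) <= 4)%N by apply: size_Poly.
move=> /(_ sh sk) H.
have /H : size (h_at c t) = 3%N \/ size (k_at c t) = 4%N.
  have [c2|c2] := eqVneq c%(2,2) 0.
    left; apply/anti_leq; rewrite sh /= ltnNge; apply/negP => h2.
    have := nth_default 0 h2; rewrite coef_Poly /= !horner_cons hornerC c2.
    by move/eqP; rewrite oppr0 mul0r !add0r mul0r add0r (negbTE a0).
  right; apply/anti_leq; rewrite sk /= ltnNge; apply/negP => k3.
  have := nth_default 0 k3; rewrite coef_Poly /= !horner_cons hornerC.
  by move/eqP; rewrite mul0r add0r (negbTE c2).
rewrite /coprimep => /closed_rootP[y]; rewrite root_gcd => /andP[/rootP hy0 /rootP ky0].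
by exists y; rewrite omega_chart hy0 ky0 !mulr0 subr0; apply: row3P; rewrite !mxE.
Qed.

Lemma singular_chi_root c t y : omega c (v3 t y 1) = 0 -> root (chi c) t.
Proof.
rewrite omega_chart => f0; apply/rootP; rewrite chiE.
apply: (@det_syl_root _ _ _ _ _ y) => //; try exact: size_Poly; apply/rootP.
  by have /rowP/(_ iy) := f0; rewrite !mxE.
by have /rowP/(_ ix) := f0; rewrite !mxE.
Qed.

Definition disc c : K :=
  \det (syl 7 6 (fun k => (chi c)`_k) (fun k => (chi c)^`()`_k)).

(** If the coefficient of degree 7 of the eliminant vanished, the last column of
    the Sylvester matrix would be zero. *)
Lemma disc_separable c : disc c != 0 -> size (chi c) = 8%N /\ separable_poly (chi c).
Proof.
move=> d0; have s8 := size_chi c; have s7 : (size (chi c)^`() <= 7)%N.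
  by rewrite (leq_trans (size_poly _ _)) //; case: (size _) s8.
have c7 : (chi c)`_7 != 0.
  apply: contraNneq d0 => c7; rewrite /disc; pose j : 'I_(6 + 7) := @Ordinal 13 12 isT.
  have chi_ge7 l : (7 <= l)%N -> (chi c)`_l = 0.
    by rewrite leq_eqVlt => /orP[/eqP<- //|l8]; apply: nth_default; apply: leq_trans l8.
  rewrite (expand_det_col _ j) big1 // => i _.
  rewrite mxE; case: splitP => k ik; rewrite mxE /syl_row; case: ifP => _; rewrite ?mul0r //.
    by rewrite chi_ge7 ?mul0r //; exact: (leq_sub2l 12 (ltn_ord k : (k <= 5)%N)).
  by rewrite coef_deriv chi_ge7 ?mul0rn ?mul0r // ltnS; exact: (leq_sub2l 12 (ltn_ord k : (k <= 6)%N)).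
have sz : size (chi c) = 8%N.
  by apply/anti_leq; rewrite s8 /= ltnNge; apply: contra c7 => /(nth_default 0) ->.
split=> //; rewrite separable_poly.unlock; apply: contraNT d0 => /closed_rootP[y].
rewrite root_gcd => /andP[r1 r2]; apply/eqP; exact: (det_syl_root s8 s7 _ r1 r2).
Qed.

Lemma disc_neq0 c : size (chi c) = 8%N -> separable_poly (chi c) -> disc c != 0.
Proof.
rewrite separable_poly.unlock => s8 sep; apply/eqP => d0.
have s7 : (size (chi c)^`() <= 7)%N by rewrite (leq_trans (size_poly _ _)) ?s8.
by move: (det_syl0P (eq_leq s8) s7 d0 (or_introl s8)); rewrite sep.
Qed.

Lemma exists_singular_config c : c%(0,0) != 0 -> disc c != 0 ->
  exists p, singular_config c p.
Proof.
move=> a0 /disc_separable[s8 sep].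
have [rs chi_split] := closed_field_poly_normal (chi c).
have chi0 : chi c != 0 by rewrite -size_poly_gt0 s8.
have srs : size rs = 7%N.
  move: s8; rewrite chi_split size_scale ?lead_coef_eq0 //.
  by rewrite size_prod_XsubC => -[].
have urs : uniq rs.
  rewrite -separable_prod_XsubC; move: sep; rewrite chi_split.
  by rewrite !separable_poly.unlock derivZ coprimepZl ?coprimepZr ?lead_coef_eq0.
have /fin_all_exists[y ysing] (i : 'I_7) : exists y, omega c (v3 rs`_i y 1) = 0.
  apply: chi_root_singular => //; rewrite chi_split rootZ ?lead_coef_eq0 //.
  by rewrite root_prod_XsubC mem_nth ?srs.
exists (fun i : 'I_7 => v3 rs`_i (y i) 1); split=> // i j ij.
apply: contraNneq ij => /rowP/(_ iy); rewrite !mxE /= !mulr1 mul1r => /subr0_eq/eqP.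
by rewrite nth_uniq ?srs ?ltn_ord // => /eqP ji; apply/eqP/val_inj.
Qed.
End Eliminant.

(** * A determinant that detects invariant lines *)

Section LineCertificate.
Variable K : numClosedFieldType.
Implicit Types (c : nat -> nat -> K) (w : nat -> nat -> nat -> K).

(** The six cubic forms l . P (l x e_i) and l . polar (l x e_i, l x e_j), i < j,
    in the coordinates of a line l, where e is the canonical basis and
    [w i j k] stands for the monomial l_0^i l_1^j l_2^k.  Keeping [w] arbitrary
    makes them linear functionals on the space of values of the monomials. *)
Definition line_eqs c w : seq K :=
  [:: c%(0,0) * w 1%N 0%N 2%N - c%(0,1) * w 1%N 1%N 1%N + c%(0,2) * w 1%N 2%N 0%N
      + c%(1,0) * w 0%N 3%N 0%N - c%(1,3) * w 0%N 2%N 1%N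
      + c%(2,2) * w 0%N 0%N 3%N - c%(2,4) * w 0%N 1%N 2%N;
      c%(0,2) * w 3%N 0%N 0%N - c%(0,4) * w 2%N 0%N 1%N + c%(1,0) * w 2%N 1%N 0%N
      - c%(1,1) * w 1%N 1%N 1%N + c%(1,2) * w 0%N 1%N 2%N
      + c%(2,0) * w 0%N 0%N 3%N - c%(2,3) * w 1%N 0%N 2%N;
      c%(0,0) * w 3%N 0%N 0%N - c%(0,3) * w 2%N 1%N 0%N + c%(1,2) * w 0%N 3%N 0%N
      - c%(1,4) * w 1%N 2%N 0%N + c%(2,0) * w 0%N 2%N 1%N
      - c%(2,1) * w 1%N 1%N 1%N + c%(2,2) * w 2%N 0%N 1%N;
      c%(0,1) * w 2%N 0%N 1%N - c%(0,2) * w 2%N 1%N 0%N *+ 2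
      - c%(0,3) * w 1%N 0%N 2%N + c%(0,4) * w 1%N 1%N 1%N
      - c%(1,0) * w 1%N 2%N 0%N *+ 2 + c%(1,1) * w 0%N 2%N 1%N
      + c%(1,3) * w 1%N 1%N 1%N - c%(1,4) * w 0%N 1%N 2%N
      - c%(2,1) * w 0%N 0%N 3%N + c%(2,3) * w 0%N 1%N 2%N + c%(2,4) * w 1%N 0%N 2%N;
      - c%(0,0) * w 2%N 0%N 1%N *+ 2 + c%(0,1) * w 2%N 1%N 0%N
      + c%(0,3) * w 1%N 1%N 1%N - c%(0,4) * w 1%N 2%N 0%N
      - c%(1,1) * w 0%N 3%N 0%N + c%(1,3) * w 1%N 2%N 0%N
      + c%(1,4) * w 0%N 2%N 1%N + c%(2,1) * w 0%N 1%N 2%N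
      - c%(2,2) * w 1%N 0%N 2%N *+ 2 - c%(2,3) * w 0%N 2%N 1%N + c%(2,4) * w 1%N 1%N 1%N;
      - c%(0,1) * w 3%N 0%N 0%N + c%(0,3) * w 2%N 0%N 1%N
      + c%(0,4) * w 2%N 1%N 0%N + c%(1,1) * w 1%N 2%N 0%N
      - c%(1,2) * w 0%N 2%N 1%N *+ 2 - c%(1,3) * w 2%N 1%N 0%N
      + c%(1,4) * w 1%N 1%N 1%N - c%(2,0) * w 0%N 1%N 2%N *+ 2
      + c%(2,1) * w 1%N 0%N 2%N + c%(2,3) * w 1%N 1%N 1%N - c%(2,4) * w 2%N 0%N 1%N].

(** The pair (a, e) stands for the product of l_a and the e-th cubic form.  These
    fifteen of the eighteen products are a basis of the quartics for the Jouanolou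
    foliation. *)
Definition multipliers : seq (nat * nat) :=
  [:: (0, 4); (1, 4); (2, 4); (0, 3); (1, 3); (2, 3); (0, 5); (1, 5); (2, 5);
      (1, 0); (2, 0); (0, 1); (2, 1); (0, 2); (1, 2)]%N.

Definition shift (a : nat) w : nat -> nat -> nat -> K := fun i j k =>
  match a with
  | 0 => w i.+1 j k
  | 1 => w i j.+1 k
  | _ => w i j k.+1
  end.

Definition cert_row c w (r : nat) : K :=
  let ae := nth (0, 0)%N multipliers r in nth 0 (line_eqs c (shift ae.1 w)) ae.2.

(** The rank of the monomial l_0^i l_1^j l_2^k of degree 4, which [j] and [k]
    determine. *)
Definition quartic_index (j k : nat) : 'I_15 :=
  inord (nth 0 (nth [::] [:: [:: 0; 2; 5; 9; 14]; [:: 1; 4; 8; 13]; [:: 3; 7; 12];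
    [:: 6; 11]; [:: 10]] j) k)%N.

(** The coefficients of the fifteen products in the fifteen quartic monomials. *)
Definition line_cert c : 'M[K]_15 :=
  \matrix_(r, n) cert_row c (fun _ j k => (quartic_index j k == n)%:R) r.

Lemma line_eqs_linear c w w' w'' s e :
  (forall i j k, (i + j + k = 3)%N -> w i j k = w' i j k * s + w'' i j k) ->
  nth 0 (line_eqs c w) e = nth 0 (line_eqs c w') e * s + nth 0 (line_eqs c w'') e.
Proof.
move=> wE; case: e => [|[|[|[|[|[|e]]]]]] /=; rewrite ?nth_nil ?wE //; ring.
Qed.

Lemma cert_row_linear c w w' w'' s r :
  (forall i j k, w i j k = w' i j k * s + w'' i j k) ->
  cert_row c w r = cert_row c w' r * s + cert_row c w'' r.
Proof.
move=> wE; apply: line_eqs_linear => i j k _.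
by case: (_.1) => [|[|a]]; rewrite /= wE.
Qed.

Lemma cert_row_sum c (I : Type) (rs : seq I) w (d : I -> nat -> nat -> nat -> K) u r :
  (forall i j k, w i j k = \sum_(n <- rs) d n i j k * u n) ->
  cert_row c w r = \sum_(n <- rs) cert_row c (d n) r * u n.
Proof.
elim: rs w => [|n rs IH] w wE.
  (* As [w] vanishes, it is equal to [w * (-1) + w]. *)
  rewrite big_nil (@cert_row_linear c w w w (-1)) ?mulrN1 ?addNr // => i j k.
  by rewrite wE big_nil mul0r addr0.
rewrite big_cons -(IH (fun i j k => \sum_(n <- rs) d n i j k * u n)) //.
by apply: cert_row_linear => i j k; rewrite wE big_cons.
Qed.

Lemma line_cert_mul c (v : 'cV_15) r :
  (line_cert c *m v) r 0 = cert_row c (fun _ j k => v (quartic_index j k) 0) r.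
Proof.
rewrite mxE; under eq_bigr do rewrite mxE.
apply/esym/cert_row_sum => i j k.
rewrite (bigD1 (quartic_index j k)) //= eqxx mul1r big1 ?addr0 // => n.
by rewrite eq_sym => /negbTE->; rewrite mul0r.
Qed.

Lemma dot_v3 (l : 'rV[K]_3) x y z :
  dot l (v3 x y z) = l 0 ix * x + l 0 iy * y + l 0 iz * z.
Proof. by rewrite /dot !mxE. Qed.

Lemma quad_v3 c x y z : quad c (v3 x y z) =
  v3 (c%(0,0) * y ^+ 2 + c%(0,1) * (y * z) + c%(0,2) * z ^+ 2
        + c%(0,3) * (x * y) + c%(0,4) * (x * z))
     (c%(1,0) * z ^+ 2 + c%(1,1) * (z * x) + c%(1,2) * x ^+ 2
        + c%(1,3) * (y * z) + c%(1,4) * (y * x))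
     (c%(2,0) * x ^+ 2 + c%(2,1) * (x * y) + c%(2,2) * y ^+ 2
        + c%(2,3) * (z * x) + c%(2,4) * (z * y)).
Proof. by rewrite /quad !mxE. Qed.

Lemma polar_v3 c x y z x' y' z' : polar c (v3 x y z) (v3 x' y' z') =
  v3 (c%(0,0) * (y * y' *+ 2) + c%(0,1) * (y * z' + y' * z)
        + c%(0,2) * (z * z' *+ 2)
        + c%(0,3) * (x * y' + x' * y) + c%(0,4) * (x * z' + x' * z))
     (c%(1,0) * (z * z' *+ 2) + c%(1,1) * (z * x' + z' * x)
        + c%(1,2) * (x * x' *+ 2)
        + c%(1,3) * (y * z' + y' * z) + c%(1,4) * (y * x' + y' * x))
     (c%(2,0) * (x * x' *+ 2) + c%(2,1) * (x * y' + x' * y)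
        + c%(2,2) * (y * y' *+ 2)
        + c%(2,3) * (z * x' + z' * x) + c%(2,4) * (z * y' + z' * y)).
Proof. by rewrite /polar !mxE. Qed.

(** The vectors l x e_i lie in the plane spanned by a and b, on which l . P and its
    polarization vanish. *)
Lemma invariant_line_eqs c (l : 'rV[K]_3) e (a b : 'rV[K]_3) : cross a b = l ->
  [/\ dot l (quad c a) = 0, dot l (polar c a b) = 0 & dot l (quad c b) = 0] ->
  nth 0 (line_eqs c (fun i j k => l 0 ix ^+ i * l 0 iy ^+ j * l 0 iz ^+ k)) e = 0.
Proof.
move=> abl [Ea Eab Eb].
have q0 u : dot l (quad c (cross l u)) = 0.
  rewrite -abl cross_cross abl -scaleNr quadDZ !dotDr !dotZr.
  have -> : polar c b a = polar c a b by rewrite /polar; vec.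
  by rewrite Ea Eab Eb !mulr0 !addr0.
have p0 u v : dot l (polar c (cross l u) (cross l v)) = 0.
  have := q0 (u + v); rewrite crossDr quadD !dotDr !q0 addr0 add0r; exact.
have c1 : cross l (v3 1 0 0) = v3 0 (l 0 iz) (- l 0 iy) by vec.
have c2 : cross l (v3 0 1 0) = v3 (- l 0 iz) 0 (l 0 ix) by vec.
have c3 : cross l (v3 0 0 1) = v3 (l 0 iy) (- l 0 ix) 0 by vec.
have := (q0 (v3 1 0 0), q0 (v3 0 1 0), q0 (v3 0 0 1)).
have := (p0 (v3 1 0 0) (v3 0 1 0), p0 (v3 1 0 0) (v3 0 0 1), p0 (v3 0 1 0) (v3 0 0 1)).
rewrite c1 c2 c3 !polar_v3 !quad_v3 !dot_v3.
move: (l 0 ix) (l 0 iy) (l 0 iz) => x y z [[p12 p13] p23] [[q1 q2] q3].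
case: e => [|[|[|[|[|[|e]]]]]]; rewrite /= ?nth_nil //.
- by rewrite -[RHS]q1; ring.
- by rewrite -[RHS]q2; ring.
- by rewrite -[RHS]q3; ring.
- by rewrite -[RHS]p12; ring.
- by rewrite -[RHS]p13; ring.
- by rewrite -[RHS]p23; ring.
Qed.

(** The values of the quartic monomials at an invariant line form a vector of the
    kernel, and those of the fourth powers do not all vanish. *)
Lemma line_cert_no_invariant_line c : \det (line_cert c) != 0 -> no_invariant_line c.
Proof.
move=> det0 a b ab; move lE : (cross a b) ab => l l0 inv.
have eqs e := invariant_line_eqs e lE inv.
pose w i j k := l 0 ix ^+ i * l 0 iy ^+ j * l 0 iz ^+ k.
pose exps : seq (nat * nat * nat) :=
  [:: (4,0,0); (3,1,0); (3,0,1); (2,2,0); (2,1,1); (2,0,2); (1,3,0); (1,2,1); (1,1,2); (1,0,3); (0,4,0); (0,3,1); (0,2,2); (0,1,3); (0,0,4)]%N.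
pose v : 'cV[K]_15 := \col_n let e := nth (0, 0, 0)%N exps n in w e.1.1 e.1.2 e.2.
have vE i j k : (i + j + k = 4)%N -> v (quartic_index j k) 0 = w i j k.
  move=> ijk; have -> : i = (4 - j - k)%N by lia.
  have : (j + k <= 4)%N by lia.
  by case: j k {ijk} => [|[|[|[|[|j]]]]] [|[|[|[|[|k]]]]] //= _;
    rewrite mxE /quartic_index inordK.
have : line_cert c *m v = 0.
  apply/colP => r; rewrite line_cert_mul [RHS]mxE /cert_row.
  set ae := nth (0, 0)%N multipliers r.
  pose x := if ae.1 is 0 then l 0 ix else if ae.1 is 1 then l 0 iy else l 0 iz.
  (* The product of [w] by [x] is written [w * (x - 1) + w]. *)
  rewrite (@line_eqs_linear _ _ w w (x - 1)) ?eqs ?mul0r ?addr0 // => i j k ijk.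
  rewrite /x; case: (ae.1) => [|[|n]] /=.
  - by rewrite (vE i.+1) ?addSn ?ijk // /w exprS; ring.
  - by rewrite (vE i) ?addnS ?addSn ?ijk // /w exprS; ring.
  - by rewrite (vE i) ?addnS ?addSn ?ijk // /w exprS; ring.
move=> cv0; have {cv0} v0 : v = 0.
  by rewrite -[v](mulKmx (_ : line_cert c \in unitmx)) ?unitmxE ?unitfE // cv0 mulmx0.
have w0 i j k : (i + j + k = 4)%N -> w i j k = 0 by move=> /vE <-; rewrite v0 mxE.
have zero x : x ^+ 4 = 0 -> x = 0 :> K by move/eqP; rewrite expf_eq0 => /eqP.
case/eqP: l0; apply: row3P; rewrite [RHS]mxE; apply: zero.
- by have := w0 4%N 0%N 0%N erefl; rewrite /w !mulr1.
- by have := w0 0%N 4%N 0%N erefl; rewrite /w mul1r mulr1.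
- by have := w0 0%N 0%N 4%N erefl; rewrite /w !mul1r.
Qed.

(** The vector field (y^2, z^2, x^2). *)
Definition jouanolou (i j : nat) : K := ((i < 3) && (j == 0))%N%:R.

(** Nine rows are multiples of a single unknown, three rows then give one more
    unknown each, and the last three unknowns have zero pairwise sums. *)
Lemma jouanolou_line_cert : \det (line_cert jouanolou) != 0.
Proof.
rewrite -det_tr; apply/det0P => -[v v0 vM]; case/negP: v0; apply/eqP.
pose u n : K := v^T (inord n) 0.
have rows n : (n < 15)%N -> cert_row jouanolou (fun _ j k => v^T (quartic_index j k) 0) n = 0.
  move=> n15; rewrite -[n]/(val (Ordinal n15)) -line_cert_mul.
  by rewrite -[line_cert _]trmxK -trmx_mul vM trmx0 mxE.
have half (x : K) : 2 * x = 0 -> x = 0 by move/eqP; rewrite mulf_eq0 pnatr_eq0 => /eqP.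
have row n (n15 : (n < 15)%N) (x : K) :
    x = cert_row jouanolou (fun _ j k => v^T (quartic_index j k) 0) n -> x = 0.
  by rewrite rows.
have u2 : u 2%N = 0.
  apply: half; apply: oppr_inj; rewrite oppr0; apply: (row 0%N) => //.
  by rewrite /cert_row /line_eqs /jouanolou /quartic_index /u /=; ring.
have u4 : u 4%N = 0.
  apply: half; apply: oppr_inj; rewrite oppr0; apply: (row 1%N) => //.
  by rewrite /cert_row /line_eqs /jouanolou /quartic_index /u /=; ring.
have u5 : u 5%N = 0.
  apply: half; apply: oppr_inj; rewrite oppr0; apply: (row 2%N) => //.
  by rewrite /cert_row /line_eqs /jouanolou /quartic_index /u /=; ring.
have u3 : u 3%N = 0.
  apply: half; apply: oppr_inj; rewrite oppr0; apply: (row 3%N) => //.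
  by rewrite /cert_row /line_eqs /jouanolou /quartic_index /u /=; ring.
have u6 : u 6%N = 0.
  apply: half; apply: oppr_inj; rewrite oppr0; apply: (row 4%N) => //.
  by rewrite /cert_row /line_eqs /jouanolou /quartic_index /u /=; ring.
have u7 : u 7%N = 0.
  apply: half; apply: oppr_inj; rewrite oppr0; apply: (row 5%N) => //.
  by rewrite /cert_row /line_eqs /jouanolou /quartic_index /u /=; ring.
have u8 : u 8%N = 0.
  apply: half; apply: oppr_inj; rewrite oppr0; apply: (row 6%N) => //.
  by rewrite /cert_row /line_eqs /jouanolou /quartic_index /u /=; ring.
have u12 : u 12%N = 0.
  apply: half; apply: oppr_inj; rewrite oppr0; apply: (row 7%N) => //.
  by rewrite /cert_row /line_eqs /jouanolou /quartic_index /u /=; ring.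
have u13 : u 13%N = 0.
  apply: half; apply: oppr_inj; rewrite oppr0; apply: (row 8%N) => //.
  by rewrite /cert_row /line_eqs /jouanolou /quartic_index /u /=; ring.
have u10 : u 10%N = 0.
  have : u 10%N + u 8%N = 0; last by rewrite u8 addr0.
  apply: (row 9%N) => //.
  by rewrite /cert_row /line_eqs /jouanolou /quartic_index /u /=; ring.
have u14 : u 14%N = 0.
  have : u 14%N + u 4%N = 0; last by rewrite u4 addr0.
  apply: (row 12%N) => //.
  by rewrite /cert_row /line_eqs /jouanolou /quartic_index /u /=; ring.
have u0 : u 0%N = 0.
  have : u 0%N + u 7%N = 0; last by rewrite u7 addr0.
  apply: (row 13%N) => //.
  by rewrite /cert_row /line_eqs /jouanolou /quartic_index /u /=; ring.
have u9_11 : u 9%N + u 11%N = 0.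
  apply: (row 10%N) => //.
  by rewrite /cert_row /line_eqs /jouanolou /quartic_index /u /=; ring.
have u1_9 : u 1%N + u 9%N = 0.
  apply: (row 11%N) => //.
  by rewrite /cert_row /line_eqs /jouanolou /quartic_index /u /=; ring.
have u1_11 : u 1%N + u 11%N = 0.
  apply: (row 14%N) => //.
  by rewrite /cert_row /line_eqs /jouanolou /quartic_index /u /=; ring.
have u1 : u 1%N = 0.
  apply: half; rewrite -[RHS]subr0 -{1}[in RHS]u1_9 -[in RHS]u9_11.
  by rewrite -[LHS]subr0 -u1_11; ring.
have u9 : u 9%N = 0 by rewrite -[RHS]u1_9 u1 add0r.
have u11 : u 11%N = 0 by rewrite -[RHS]u1_11 u1 add0r.
apply/rowP => n; rewrite [RHS]mxE.
have -> : v 0 n = u n by rewrite /u mxE inord_val.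
by case: n => -[|[|[|[|[|[|[|[|[|[|[|[|[|[|[|//]]]]]]]]]]]]]]] /=.
Qed.
End LineCertificate.

(** * Functions given by forms *)

(** The Leibniz formula, for any graded notion of function closed under sums and
    products; it serves for forms and for polynomials with forms as coefficients. *)
Section GradedDeterminant.
Variables (X : Type) (A : comNzRingType) (H : nat -> (X -> A) -> Prop).
Hypothesis H_ext : forall d f g, f =1 g -> H d f -> H d g.
Hypothesis H0 : forall d, H d (fun=> 0).
Hypothesis H1 : H 0 (fun=> 1).
Hypothesis HN : forall d f, H d f -> H d (fun x => - f x).
Hypothesis HD : forall d f g, H d f -> H d g -> H d (fun x => f x + g x).
Hypothesis HM : forall d e f g, H d f -> H e g -> H (d + e) (fun x => f x * g x).

Lemma graded_sum d (I : Type) (r : seq I) (f : I -> X -> A) :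
  (forall i, H d (f i)) -> H d (fun x => \sum_(i <- r) f i x).
Proof.
move=> Hf; elim: r => [|i r IH].
  by apply: H_ext (H0 d) => x; rewrite big_nil.
by apply: H_ext (HD (Hf i) IH) => x; rewrite big_cons.
Qed.

Lemma graded_prod d (I : Type) (r : seq I) (f : I -> X -> A) :
  (forall i, H d (f i)) -> H (size r * d) (fun x => \prod_(i <- r) f i x).
Proof.
move=> Hf; elim: r => [|i r IH].
  by apply: H_ext H1 => x; rewrite big_nil.
by apply: H_ext (HM (Hf i) IH) => x; rewrite big_cons.
Qed.

Lemma graded_det d k (M : X -> 'M[A]_k) :
  (forall i j, H d (fun x => M x i j)) -> H (k * d) (fun x => \det (M x)).
Proof.
move=> HM'; apply: graded_sum => s.
have := graded_prod (index_enum 'I_k) (fun i => HM' i (s i)).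
rewrite /index_enum -enumT size_enum_ord; case: (perm.odd_perm s) => /= Hp.
  by apply: H_ext (HN Hp) => x; rewrite expr1 mulN1r.
by apply: H_ext Hp => x; rewrite expr0 mul1r.
Qed.
End GradedDeterminant.

Section FormFunctions.
Variables (K : fieldType) (n : nat).
Implicit Types (f g : 'rV[K]_n -> K) (P Q : 'rV[K]_n -> {poly K}).

Definition form_fun d f :=
  exists2 G : {mpoly K[n]}, G \is d.-homog & forall x : 'rV[K]_n, G.@[x 0] = f x.

Lemma form_ext d f g : f =1 g -> form_fun d f -> form_fun d g.
Proof. by move=> fg [G Gd Gf]; exists G => // x; rewrite Gf. Qed.

Lemma form_const a : form_fun 0 (fun=> a).
Proof.
exists a%:MP => [|x]; last by rewrite mevalC.
by rewrite -[a%:MP]mulr1 mul_mpolyC rpredZ // dhomog1.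
Qed.

Lemma form0 d : form_fun d (fun=> 0).
Proof. by exists 0 => [|x]; rewrite ?dhomog0 ?meval0. Qed.

Lemma form_coord i : form_fun 1 (fun x => x 0 i).
Proof. by exists 'X_i => [|x]; rewrite ?mevalXU // dhomogX /= mdeg1. Qed.

Lemma formN d f : form_fun d f -> form_fun d (fun x => - f x).
Proof.
by case=> G Gd Gf; exists (- G) => [|x]; rewrite ?rpredN // mevalN Gf.
Qed.

Lemma formD d f g : form_fun d f -> form_fun d g -> form_fun d (fun x => f x + g x).
Proof.
case=> G Gd Gf [G' G'd G'g]; exists (G + G') => [|x]; first by rewrite rpredD.
by rewrite mevalD Gf G'g.
Qed.

Lemma formM d e f g :
  form_fun d f -> form_fun e g -> form_fun (d + e) (fun x => f x * g x).
Proof.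
case=> G Gd Gf [G' G'd G'g]; exists (G * G') => [|x]; first exact: dhomogM.
by rewrite mevalM Gf G'g.
Qed.

Lemma formMc d f a : form_fun d f -> form_fun d (fun x => f x * a).
Proof. by move=> /formM/(_ (form_const a)); rewrite addn0. Qed.

Lemma formMn d f k : form_fun d f -> form_fun d (fun x => f x *+ k).
Proof.
by move=> /(formMc k%:R); apply: form_ext => x; rewrite mulr_natr.
Qed.

Definition form_det := graded_det form_ext form0 (form_const 1) formN formD formM.
Definition form_sum := graded_sum form_ext form0 formD.

Lemma form_open d f : form_fun d f -> zariski_open (fun x => f x != 0).
Proof.
case=> G Gd Gf; exists (eq^~ G) => [_ ->|x _]; first by exists d.
by split=> [fx|[_ ->]]; [exists G; rewrite ?Gf|rewrite Gf].
Qed.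

Definition poly_form d P := forall i, form_fun d (fun x => (P x)`_i).

Lemma poly_form_det d k (M : 'rV[K]_n -> 'M[{poly K}]_k) :
  (forall i j, poly_form d (fun x => M x i j)) ->
  poly_form (k * d) (fun x => \det (M x)).
Proof.
apply: (graded_det (H := poly_form)) => [e P Q PQ HP i|e i||e P HP i|e P Q HP HQ i|d1 d2 P Q HP HQ i].
- by apply: form_ext (HP i) => x; rewrite PQ.
- by apply: form_ext (form0 e) => x; rewrite coef0.
- by move=> i; apply: form_ext (form_const _) => x; rewrite coef1.
- by apply: form_ext (formN (HP i)) => x; rewrite coefN.
- by apply: form_ext (formD (HP i) (HQ i)) => x; rewrite coefD.
- have := form_sum (index_enum 'I_i.+1) (fun j => formM (HP j) (HQ (i - j)%N)).
  by apply: form_ext => x; rewrite coefM.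
Qed.

Definition field_form d (c : 'rV[K]_n -> nat -> nat -> K) :=
  forall i j, form_fun d (fun x => c x i j).

Definition vector_form d (v : 'rV[K]_n -> 'rV[K]_3) :=
  forall i, form_fun d (fun x => v x 0 i).

Lemma vector_form3 d f g h : form_fun d f -> form_fun d g -> form_fun d h ->
  vector_form d (fun x => v3 (f x) (g x) (h x)).
Proof.
by move=> Hf Hg Hh; elim/I3_ind; [move: Hf|move: Hg|move: Hh];
  apply: form_ext => x; rewrite mxE.
Qed.

Lemma form_dot d e u v : vector_form d u -> vector_form e v ->
  form_fun (d + e) (fun x => dot (u x) (v x)).
Proof. by move=> Hu Hv; rewrite /dot; do 2?apply: formD; apply: formM. Qed.

Lemma form_cross d e u v : vector_form d u -> vector_form e v ->
  vector_form (d + e) (fun x => cross (u x) (v x)).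
Proof.
by move=> Hu Hv; apply: vector_form3; (apply: formD; last apply: formN); apply: formM.
Qed.

Lemma form_polar d e1 e2 c u v :
  field_form d c -> vector_form e1 u -> vector_form e2 v ->
  vector_form (d + (e1 + e2)) (fun x => polar (c x) (u x) (v x)).
Proof.
move=> Hc Hu Hv; have uv i j : form_fun (e1 + e2) (fun x => u x 0 i * v x 0 j).
  exact: formM.
have vu i j : form_fun (e1 + e2) (fun x => v x 0 i * u x 0 j).
  by rewrite addnC; apply: formM.
by apply: vector_form3; do 4?apply: formD; apply: formM => //;
  rewrite ?mulr2n; apply: formD.
Qed.

Lemma form_quad d e c u : field_form d c -> vector_form e u ->
  vector_form (d + (e + e)) (fun x => quad (c x) (u x)).
Proof.
move=> Hc Hu; have uu i j : form_fun (e + e) (fun x => u x 0 i * u x 0 j).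
  exact: formM.
by apply: vector_form3; do 4?apply: formD; apply: formM => //; apply: uu.
Qed.

Lemma form_cast d e f : d = e -> form_fun d f -> form_fun e f.
Proof. by move=> ->. Qed.

Lemma form_omega d e c u : field_form d c -> vector_form e u ->
  vector_form (d + 3 * e) (fun x => omega (c x) (u x)).
Proof.
move=> Hc Hu i; apply: form_cast (form_cross Hu (form_quad Hc Hu) i); lia.
Qed.

Lemma form_tanT d e c u : field_form d c -> vector_form e u ->
  form_fun (3 * d + 6 * e) (fun x => tanT (c x) (u x)).
Proof.
move=> Hc Hu; have Hq := form_quad Hc Hu.
apply: form_cast (form_dot (form_omega Hc Hu) (form_polar Hc Hu Hq)); lia.
Qed.

Lemma form_tanS d e c u : field_form d c -> vector_form e u ->
  form_fun (4 * d + 7 * e) (fun x => tanS (c x) (u x)).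
Proof.
move=> Hc Hu; have Hq := form_quad Hc Hu.
apply: form_cast (form_dot (form_omega Hc Hu) (form_quad Hc Hq)); lia.
Qed.

Lemma form_involution d e c u : field_form d c -> vector_form e u ->
  vector_form (4 * d + 8 * e) (fun x => involution (c x) (u x)).
Proof.
move=> Hc Hu i; have Hq := form_quad Hc Hu.
have HS : form_fun (4 * d + 8 * e) (fun x => tanS (c x) (u x) * u x 0 i).
  apply: form_cast (formM (form_tanS Hc Hu) (Hu i)); lia.
have HT : form_fun (4 * d + 8 * e) (fun x => tanT (c x) (u x) * quad (c x) (u x) 0 i).
  apply: form_cast (formM (form_tanT Hc Hu) (Hq i)); lia.
by apply: form_ext (formD HS (formN HT)) => x; rewrite /involution !mxE.
Qed.
End FormFunctions.

Section GenericityConditions.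
Variables (K : numClosedFieldType) (n : nat) (c : 'rV[K]_n -> nat -> nat -> K).
Hypothesis Hc : field_form 1 c.

Lemma form_line_cert : form_fun 15 (fun x => \det (line_cert (c x))).
Proof.
apply: (form_det (k := 15) (d := 1)) => r j.
apply: (form_ext (f := fun x => cert_row (c x) (fun _ i k => (quartic_index i k == j)%:R) r)).
  by move=> x; rewrite mxE.
rewrite /cert_row; move: (nth _ multipliers r) => [a e] /=.
move: (shift a _) => w; case: e => [|[|[|[|[|[|e]]]]]] /=; last first.
  by apply: form_ext (form0 _ _ _) => x; rewrite nth_nil.
all: repeat first [apply: formN | apply: formMc | apply: formMn | exact: Hc | apply: formD].
Qed.

Lemma poly_form_tab (tab : 'rV[K]_n -> seq (seq K)) k :
  (forall i, form_fun 1 (fun x => (nth [::] (tab x) k)`_i)) ->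
  poly_form 1 (fun x => tabpoly (tab x) k).
Proof. by move=> Ht i; apply: form_ext (Ht i) => x; rewrite coef_Poly. Qed.

Lemma poly_form_chi : poly_form 5 (fun x => chi (c x)).
Proof.
apply: (poly_form_det (k := 5) (d := 1)) => i j.
have zero : poly_form 1 (fun _ : 'rV[K]_n => 0 : {poly K}).
  by move=> l; apply: form_ext (form0 _ _ _) => x; rewrite coef0.
have Hh k : poly_form 1 (fun x => tabpoly (htab (c x)) k).
  apply: poly_form_tab => l; case: k => [|[|[|k]]]; case: l => [|[|[|[|l]]]] /=;
  rewrite ?nth_nil; repeat first [exact: form0 | exact: Hc | apply: formN | apply: formD].
have Hk k : poly_form 1 (fun x => tabpoly (ktab (c x)) k).
  apply: poly_form_tab => l; case: k => [|[|[|[|k]]]]; case: l => [|[|[|[|l]]]] /=;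
  rewrite ?nth_nil; repeat first [exact: form0 | exact: Hc | apply: formN | apply: formD].
rewrite /syl; case: (@splitP 3 2 i) => k ik.
- have -> : i = lshift 2 k by apply: val_inj.
  move=> l; case jk : (j < k)%N.
    by apply: form_ext (zero l) => x; rewrite (@col_mxEu _ 3 2) mxE /syl_row jk.
  by apply: form_ext (Hh _ l) => x; rewrite (@col_mxEu _ 3 2) mxE /syl_row jk.
- have -> : i = rshift 3 k by apply: val_inj.
  move=> l; case jk : (j < k)%N.
    by apply: form_ext (zero l) => x; rewrite (@col_mxEd _ 3 2) mxE /syl_row jk.
  by apply: form_ext (Hk _ l) => x; rewrite (@col_mxEd _ 3 2) mxE /syl_row jk.
Qed.

Lemma form_disc : form_fun 65 (fun x => disc (c x)).
Proof.
apply: (form_det (k := 13) (d := 5)) => i j.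
rewrite /syl; case: (@splitP 6 7 i) => k ik.
- have -> : i = lshift 7 k by apply: val_inj.
  case jk : (j < k)%N.
    by apply: form_ext (form0 _ _ _) => x; rewrite (@col_mxEu _ 6 7) mxE /syl_row jk.
  apply: form_ext (poly_form_chi (j - k)%N) => x.
  by rewrite (@col_mxEu _ 6 7) mxE /syl_row jk.
- have -> : i = rshift 6 k by apply: val_inj.
  case jk : (j < k)%N.
    by apply: form_ext (form0 _ _ _) => x; rewrite (@col_mxEd _ 6 7) mxE /syl_row jk.
  apply: form_ext (formMn (j - k).+1 (poly_form_chi (j - k).+1)) => x.
  by rewrite (@col_mxEd _ 6 7) mxE /syl_row jk coef_deriv.
Qed.
End GenericityConditions.

(** * Quadratic foliations in coordinates *)

Section Coordinates.
Variable K : numClosedFieldType.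
Implicit Types (f g p : {mpoly K[3]}) (F : 'I_3 -> {mpoly K[3]}).

Definition mnm3 (a b d : nat) : 'X_{1..3} := [multinom nth 0 [:: a; b; d] i | i < 3]%N.

Lemma mnm3E a b d : (mnm3 a b d ix = a) * (mnm3 a b d iy = b) * (mnm3 a b d iz = d).
Proof. by rewrite !mnmE. Qed.

Lemma mdeg_mnm3 a b d : mdeg (mnm3 a b d) = (a + b + d)%N.
Proof. by rewrite mdegE sum3 !mnm3E. Qed.

Lemma mnm3_eta (e : 'X_{1..3}) : e = mnm3 (e ix) (e iy) (e iz).
Proof. by apply/mnmP; elim/I3_ind; rewrite mnm3E. Qed.

Lemma eq_mnm3 a b d a' b' d' :
  (mnm3 a b d == mnm3 a' b' d') = [&& a == a', b == b' & d == d'].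
Proof.
apply/eqP/and3P => [/mnmP e|[/eqP-> /eqP-> /eqP->] //].
by have := (e ix, e iy, e iz); rewrite !mnm3E => -[[-> ->] ->].
Qed.

Lemma mcoeffMXi i p (e : 'X_{1..3}) :
  ('X_i * p)@_e = if e i == 0%N then 0 else p@_(e - U_(i))%MM.
Proof.
case: ifP => [/eqP ei|/negbT ei]; last first.
  have Ue : (U_(i) <= e)%MM by rewrite lep1mP.
  by rewrite mulrC -[in LHS](submK Ue) addmC mcoeffMX.
rewrite [p]mpolyE mulr_sumr raddf_sum big1 // => k _ /=.
rewrite -scalerAr mcoeffZ -mpolyXD mcoeffX.
case: eqP => [ke|_]; last by rewrite mulr0.
by move: ei; rewrite -ke mnmDE mnm1E eqxx.
Qed.

Definition form_coef F (i : 'I_3) (a b d : nat) : K := (F i)@_(mnm3 a b d).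

(** With omega = (y C - z B, z A - x C, x B - y A), the normalization of P makes
    each of its 15 coefficients, up to sign, a coefficient of omega. *)
Definition field_of (u : 'I_3 -> nat -> nat -> nat -> K) (i j : nat) : K :=
  nth 0 (nth [::]
    [:: [:: - u iz 0 3 0; - u iz 0 2 1; - u iz 0 1 2; - u iz 1 2 0; u iy 1 0 2];
        [:: - u ix 0 0 3; - u ix 1 0 2; - u ix 2 0 1; - u ix 0 1 2; u iz 2 1 0];
        [:: - u iy 3 0 0; - u iy 2 1 0; - u iy 1 2 0; - u iy 2 0 1; u ix 0 2 1]]%N i) j.

Definition cubic_form (k : nat -> nat -> nat -> K) (x y z : K) : K :=
  k 3%N 0%N 0%N * x ^+ 3 + k 2%N 1%N 0%N * (x ^+ 2 * y) + k 2%N 0%N 1%N * (x ^+ 2 * z)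
  + k 1%N 2%N 0%N * (x * y ^+ 2) + k 1%N 1%N 1%N * (x * y * z)
  + k 1%N 0%N 2%N * (x * z ^+ 2) + k 0%N 3%N 0%N * y ^+ 3 + k 0%N 2%N 1%N * (y ^+ 2 * z)
  + k 0%N 1%N 2%N * (y * z ^+ 2) + k 0%N 0%N 3%N * z ^+ 3.

Lemma cubic_meval f (m : 'rV[K]_3) : f \is 3.-homog ->
  f.@[m 0] = cubic_form (fun a b d => f@_(mnm3 a b d)) (m 0 ix) (m 0 iy) (m 0 iz).
Proof.
move=> fh; set x := m 0 ix; set y := m 0 iy; set z := m 0 iz.
set k := fun a b d => f@_(mnm3 a b d); rewrite /cubic_form.
pose T := [:: (3,0,0); (2,1,0); (2,0,1); (1,2,0); (1,1,1); (1,0,2); (0,3,0); (0,2,1);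
  (0,1,2); (0,0,3)]%N.
pose M (t : nat * nat * nat) := mnm3 t.1.1 t.1.2 t.2.
have -> : f = \sum_(t <- T) k t.1.1 t.1.2 t.2 *: 'X_[M t].
  apply/mpolyP => e; rewrite raddf_sum /=.
  have [e3|e3] := eqVneq (mdeg e) 3; last first.
    rewrite (dhomog_nemf_coeff fh e3) big_seq big1 // => t tT.
    rewrite mcoeffZ mcoeffX; case: eqP => [te|_]; last by rewrite mulr0.
    case/eqP: e3; rewrite -te mdeg_mnm3.
    by move: tT; rewrite !inE => /or4P[|||/or4P[|||/or4P[]]] /eqP->.
  pose t := (e ix, e iy, e iz).
  have eE : e = M t by rewrite /M [LHS]mnm3_eta.
  have tT : t \in T.
    move: e3; rewrite mdegE sum3 /t; move: (e ix) (e iy) (e iz) => a b d.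
    by case: a => [|[|[|[|a]]]]; case: b => [|[|[|[|b]]]]; case: d => [|[|[|[|d]]]].
  rewrite (bigD1_seq t) //= big1 => [|t' t't].
    by rewrite mcoeffZ mcoeffX -eE eqxx mulr1 addr0 [in LHS]eE.
  rewrite mcoeffZ mcoeffX eE /M eq_mnm3; case: and3P => [[/eqP h1 /eqP h2 /eqP h3]|_].
    by case/eqP: t't; case: t' h1 h2 h3 => [[a b] d] /= -> -> ->.
  by rewrite mulr0.
have me t : 'X_[M t].@[m 0] = x ^+ t.1.1 * y ^+ t.1.2 * z ^+ t.2.
  by rewrite mevalX !big_ord_recl big_ord0 !mnm3E mulr1 mulrA.
rewrite !big_cons big_nil !mevalD !mevalZ !me meval0; cbn [fst snd].
by move: k x y z {me fh} => k x y z; ring.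
Qed.

(** The Euler relation amounts to 15 linear relations, one for each monomial of
    degree 4; each of them expresses one of the 15 other coefficients of omega by
    those that [field_of] selects. *)
Lemma foliation_eval F (m : 'rV[K]_3) : is_foliation 2 F ->
  eval_forms F m = omega (field_of (form_coef F)) m.
Proof.
case=> Fh Frel _.
set U := form_coef F; set u := U ix; set v := U iy; set w := U iz.
have R a b d : (if a is a'.+1 then u a' b d else 0) +
    (if b is b'.+1 then v a b' d else 0) + (if d is d'.+1 then w a b d' else 0) = 0.
  have := congr1 (mcoeff (mnm3 a b d)) Frel.
  rewrite sum3 !mcoeffD !mcoeffMXi mcoeff0 !mnm3E => rel; rewrite -[RHS]rel {rel}.
  congr (_ + _ + _).
  - case: a => [|a] //=; rewrite /u /U /form_coef; congr (mcoeff _ _); apply/mnmP.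
    by elim/I3_ind; rewrite mnmBE mnm1E !mnm3E /= ?subn0 ?subn1.
  - case: b => [|b] //=; rewrite /v /U /form_coef; congr (mcoeff _ _); apply/mnmP.
    by elim/I3_ind; rewrite mnmBE mnm1E !mnm3E /= ?subn0 ?subn1.
  - case: d => [|d] //=; rewrite /w /U /form_coef; congr (mcoeff _ _); apply/mnmP.
    by elim/I3_ind; rewrite mnmBE mnm1E !mnm3E /= ?subn0 ?subn1.
have ew003 : w 0%N 0%N 3%N = 0.
  by rewrite -[LHS]subr0 -[X in _ - X = _](R 0%N 0%N 4%N) /=; ring.
have ev003 : v 0%N 0%N 3%N = - w 0%N 1%N 2%N.
  by rewrite -[LHS]subr0 -[X in _ - X = _](R 0%N 1%N 3%N) /=; ring.
have ev012 : v 0%N 1%N 2%N = - w 0%N 2%N 1%N.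
  by rewrite -[LHS]subr0 -[X in _ - X = _](R 0%N 2%N 2%N) /=; ring.
have ev021 : v 0%N 2%N 1%N = - w 0%N 3%N 0%N.
  by rewrite -[LHS]subr0 -[X in _ - X = _](R 0%N 3%N 1%N) /=; ring.
have ev030 : v 0%N 3%N 0%N = 0.
  by rewrite -[LHS]subr0 -[X in _ - X = _](R 0%N 4%N 0%N) /=; ring.
have ew102 : w 1%N 0%N 2%N = - u 0%N 0%N 3%N.
  by rewrite -[LHS]subr0 -[X in _ - X = _](R 1%N 0%N 3%N) /=; ring.
have ew111 : w 1%N 1%N 1%N = - u 0%N 1%N 2%N - v 1%N 0%N 2%N.
  by rewrite -[LHS]subr0 -[X in _ - X = _](R 1%N 1%N 2%N) /=; ring.
have ev111 : v 1%N 1%N 1%N = - u 0%N 2%N 1%N - w 1%N 2%N 0%N.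
  by rewrite -[LHS]subr0 -[X in _ - X = _](R 1%N 2%N 1%N) /=; ring.
have eu030 : u 0%N 3%N 0%N = - v 1%N 2%N 0%N.
  by rewrite -[LHS]subr0 -[X in _ - X = _](R 1%N 3%N 0%N) /=; ring.
have ew201 : w 2%N 0%N 1%N = - u 1%N 0%N 2%N.
  by rewrite -[LHS]subr0 -[X in _ - X = _](R 2%N 0%N 2%N) /=; ring.
have eu111 : u 1%N 1%N 1%N = - v 2%N 0%N 1%N - w 2%N 1%N 0%N.
  by rewrite -[LHS]subr0 -[X in _ - X = _](R 2%N 1%N 1%N) /=; ring.
have eu120 : u 1%N 2%N 0%N = - v 2%N 1%N 0%N.
  by rewrite -[LHS]subr0 -[X in _ - X = _](R 2%N 2%N 0%N) /=; ring.
have ew300 : w 3%N 0%N 0%N = - u 2%N 0%N 1%N.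
  by rewrite -[LHS]subr0 -[X in _ - X = _](R 3%N 0%N 1%N) /=; ring.
have eu210 : u 2%N 1%N 0%N = - v 3%N 0%N 0%N.
  by rewrite -[LHS]subr0 -[X in _ - X = _](R 3%N 1%N 0%N) /=; ring.
have eu300 : u 3%N 0%N 0%N = 0.
  by rewrite -[LHS]subr0 -[X in _ - X = _](R 4%N 0%N 0%N) /=; ring.
have Ei i : (F i).@[m 0] = cubic_form (U i) (m 0 ix) (m 0 iy) (m 0 iz).
  exact: cubic_meval (Fh i).
apply: row3P; rewrite /omega /quad /cross /v3 !mxE /= Ei /cubic_form /field_of /=;
  rewrite -/u -/v -/w; move: (m 0 ix) (m 0 iy) (m 0 iz) => x y z {Ei R}.
- rewrite eu300 eu210 eu120 eu111 eu030; clearbody u v w; ring.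
- rewrite ev111 ev030 ev021 ev012 ev003; clearbody u v w; ring.
- rewrite ew300 ew201 ew111 ew102 ew003; clearbody u v w; ring.
Qed.
End Coordinates.

(** * The Jouanolou foliation *)

Section JouanolouFoliation.
Variable K : numClosedFieldType.

Definition jouanolou_form (i : 'I_3) : {mpoly K[3]} :=
  nth 0 [:: 'X_[mnm3 2 1 0] - 'X_[mnm3 0 0 3]; 'X_[mnm3 0 2 1] - 'X_[mnm3 3 0 0];
            'X_[mnm3 1 0 2] - 'X_[mnm3 0 3 0]] i.

Lemma meval_mnm3 a b d (m : 'rV[K]_3) :
  'X_[mnm3 a b d].@[m 0] = m 0 ix ^+ a * m 0 iy ^+ b * m 0 iz ^+ d.
Proof. by rewrite mevalX !big_ord_recl big_ord0 !mnm3E mulr1 mulrA. Qed.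

Lemma msize2_lform (f : {mpoly K[3]}) : (msize f <= 2)%N ->
  f = (f@_0)%:MP + lform (v3 f@_U_(ix) f@_U_(iy) f@_U_(iz)).
Proof.
move=> f2; apply/mpolyP => e; rewrite /lform !mcoeffD !mcoeffZ mcoeffC !mxE /=.
have [e2|] := ltnP 1 (mdeg e).
  have fe : f@_e = 0.
    apply/eqP; rewrite mcoeff_eq0; apply/negP => /msize_mdeg_lt.
    by move=> /leq_trans/(_ f2); rewrite ltnNge e2.
  rewrite fe !mcoeffX; have [e0|_] := eqVneq e 0%MM; first by rewrite e0 mdeg0 in e2.
  have Ue i : (U_(i)%MM == e) = false by apply/eqP => Ue; rewrite -Ue mdeg1 in e2.
  by rewrite !Ue !mulr0 !addr0.
rewrite leq_eqVlt => /orP[/mdeg1P[i /eqP->]|].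
  rewrite !mcoeffXU mnm1_eq0 mulr0 add0r.
  by elim/I3_ind: i; rewrite /= !(mulr0, mulr1, addr0, add0r).
rewrite ltnS leqn0 mdeg_eq0 => /eqP->; rewrite !mcoeffX eqxx mulr1.
by rewrite !mnm1_eq0 !mulr0 !addr0.
Qed.

Lemma mlead_jouanolou :
  (mlead (jouanolou_form ix) = mnm3 2 1 0) * (mlead (jouanolou_form iy) = mnm3 3 0 0)
  * (mlead (jouanolou_form iz) = mnm3 1 0 2).
Proof.
have lt a b d b' d' a' : (a + b + d = a' + b' + d')%N -> (a' < a)%N ->
    (mnm3 a' b' d' < mnm3 a b d)%O.
  move=> deg aa'; apply/ltmcP; first by rewrite !mdeg_mnm3.
  by exists ix => [j|]; rewrite ?mnm3E.
rewrite /jouanolou_form /=; do 2?split.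
- by rewrite mleadDl ?mleadN !mleadXm //; apply: lt.
- by rewrite addrC mleadDl ?mleadN !mleadXm //; apply: lt.
- by rewrite mleadDl ?mleadN !mleadXm //; apply: lt.
Qed.

(** The leading monomial of a common divisor d divides x^2 y, x^3 and x z^2, so it
    is 1 or x.  If it is x, then d vanishes at some point (x, 0, 1), where the
    component x^2 y - z^3 does not. *)
Lemma jouanolou_foliation : is_foliation 2 jouanolou_form.
Proof.
split=> [|| d dvd].
- by elim/I3_ind; rewrite rpredB // dhomogX /= mdeg_mnm3.
- have XE a b e i : 'X_i * 'X_[mnm3 a b e] =
      'X_[U_(i) + mnm3 a b e]%MM :> {mpoly K[3]} by rewrite mpolyXD.
  have U0 a b e : (U_(ix) + mnm3 a b e)%MM = mnm3 a.+1 b e.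
    by apply/mnmP; elim/I3_ind; rewrite mnmDE mnm1E !mnm3E.
  have U1 a b e : (U_(iy) + mnm3 a b e)%MM = mnm3 a b.+1 e.
    by apply/mnmP; elim/I3_ind; rewrite mnmDE mnm1E !mnm3E.
  have U2 a b e : (U_(iz) + mnm3 a b e)%MM = mnm3 a b e.+1.
    by apply/mnmP; elim/I3_ind; rewrite mnmDE mnm1E !mnm3E.
  rewrite sum3 /jouanolou_form /= !mulrBr !XE !U0 !U1 !U2; ring.
have F0 i : jouanolou_form i != 0.
  elim/I3_ind: i; apply/eqP => F0; have := mlead_jouanolou;
  rewrite F0 mlead0 => -[[h1 h2] h3].
  - by have := congr1 (fun e : 'X_{1..3} => e ix) h1; rewrite mnm3E mnm0E.
  - by have := congr1 (fun e : 'X_{1..3} => e ix) h2; rewrite mnm3E mnm0E.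
  - by have := congr1 (fun e : 'X_{1..3} => e ix) h3; rewrite mnm3E mnm0E.
have lead i : exists e, mlead (jouanolou_form i) = (mlead d + e)%MM.
  have [a da] := dvd i; exists (mlead a); rewrite da mleadM //.
    by apply: contraNneq (F0 i) => d0; rewrite da d0 mul0r.
  by apply: contraNneq (F0 i) => a0; rewrite da a0 mulr0.
have [[[e0 l0] [e1 l1]] [e2 l2]] := (lead ix, lead iy, lead iz).
rewrite !mlead_jouanolou in l0 l1 l2.
have d1 : mlead d iy = 0%N.
  by have := congr1 (fun e : 'X_{1..3} => e iy) l1; rewrite mnmDE mnm3E; case: (mlead d iy).
have d2 : mlead d iz = 0%N.
  by have := congr1 (fun e : 'X_{1..3} => e iz) l0; rewrite mnmDE mnm3E; case: (mlead d iz).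
have d0 : (mlead d ix <= 1)%N.
  by have := congr1 (fun e : 'X_{1..3} => e ix) l2; rewrite mnmDE mnm3E => h;
    rewrite (leq_trans (leq_addr (e2 ix) _)) // -h.
have dn0 : d != 0.
  by apply: contraNneq (F0 ix) => dz; have [a ->] := dvd ix; rewrite dz mul0r.
have sd := mlead_deg dn0; rewrite mdegE sum3 d1 d2 !addr0 in sd.
have [x0|x0] := eqVneq (mlead d ix) 0%N.
  have /msize_poly1P[k k0 ->] : msize d == 1%N by rewrite -sd x0.
  by rewrite rmorph_unit // unitfE.
have lead1 : mlead d = U_(ix)%MM.
  by apply/mnmP; elim/I3_ind; rewrite mnm1E ?d1 ?d2 //; case: (mlead d ix) d0 x0 => [|[]].
have v0 : d@_U_(ix) != 0 by rewrite -lead1 mleadc_eq0.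
have dE := msize2_lform (_ : (msize d <= 2)%N).
rewrite -sd ltnS in dE; have {}dE := dE d0.
set v := v3 _ _ _ in dE; set k := d@_0 in dE.
pose m : 'rV[K]_3 := v3 (- (k + d@_U_(iz)) / d@_U_(ix)) 0 1.
have dm : d.@[m 0] = 0.
  rewrite [X in X.@[_]]dE mevalD mevalC lformE /dot /m /v !mxE /=.
  by rewrite -/k; field.
have [a Fa] := dvd ix; have := congr1 (fun f => f.@[m 0]) Fa.
rewrite mevalM dm mul0r /jouanolou_form /= mevalB !meval_mnm3 /m !mxE /= => /eqP.
by rewrite expr1 expr0 expr1n mulr0 !mul0r sub0r !mulr1 oppr_eq0 oner_eq0.
Qed.

Lemma jouanolou_field : field_of (form_coef jouanolou_form) = jouanolou K.
Proof.
apply/funext => i; apply/funext => j.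
have coef e (l : 'I_3) : (jouanolou_form l)@_e =
    nth 0 [:: (mnm3 2 1 0 == e)%:R - (mnm3 0 0 3 == e)%:R;
      (mnm3 0 2 1 == e)%:R - (mnm3 3 0 0 == e)%:R;
      (mnm3 1 0 2 == e)%:R - (mnm3 0 3 0 == e)%:R] l.
  by elim/I3_ind: l; rewrite mcoeffB !mcoeffX.
rewrite /field_of /form_coef !coef /= !eq_mnm3 /= ?subr0 ?sub0r ?oppr0 ?opprK.
by case: i => [|[|[|i]]]; case: j => [|[|[|[|[|j]]]]]; rewrite /= ?nth_nil.
Qed.

(** The points (t : t^5 : 1) with t^7 = 1 are singular, so the eliminant is a
    nonzero multiple of X^7 - 1. *)
Lemma jouanolou_disc : disc (jouanolou K) != 0.
Proof.
have c00 : jouanolou K 0%N 0%N != 0 by rewrite /jouanolou oner_eq0.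
have sep7 : separable_poly ('X^7 - 1 : {poly K}).
  by apply: separable_Xn_sub_1; rewrite pnatr_eq0.
have s7 : size ('X^7 - 1 : {poly K}) = 8%N by rewrite size_XnsubC.
have [rs rsE] := closed_field_poly_normal ('X^7 - 1 : {poly K}).
rewrite lead_coefXnsubC // scale1r in rsE.
have dv : 'X^7 - 1 %| chi (jouanolou K).
  rewrite rsE; apply: uniq_roots_dvdp.
    apply/allP => t trs; apply: (@singular_chi_root _ _ _ (t ^+ 5)).
    have t7 : t ^+ 7 = 1.
      have : root ('X^7 - 1) t by rewrite rsE root_prod_XsubC.
      by rewrite /root hornerD hornerN hornerXn hornerC subr_eq0 => /eqP.
    apply: row3P; rewrite /omega /quad /cross /v3 !mxE /= /jouanolou /=.
    - by transitivity (t ^+ 7 - 1); [ring | rewrite t7 subrr].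
    - by transitivity (t ^+ 3 * (t ^+ 7 - 1)); [ring | rewrite t7 subrr mulr0].
    - by transitivity (t * (1 - t ^+ 7 * t ^+ 7)); [ring | rewrite t7 mulr1 subrr mulr0].
  by rewrite uniq_rootsE -separable_prod_XsubC -rsE.
have chi0 : chi (jouanolou K) != 0.
  apply/eqP => chi0; have [|y] := @chi_root_singular K (jouanolou K) 0 c00.
    by rewrite chi0 root0.
  move=> /rowP/(_ ix); rewrite /omega /quad /cross /v3 !mxE /= /jouanolou /=.
  by move=> h; case/eqP: (oner_neq0 K); rewrite -[RHS]oppr0 -[in RHS]h; ring.
have s8 : size (chi (jouanolou K)) = 8%N.
  by apply/anti_leq; rewrite size_chi -[X in (X <= _)%N]s7 dvdp_leq.
apply: disc_neq0 => //.
rewrite -(eqp_separable (_ : 'X^7 - 1 %= _)) //.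
by rewrite -(dvdp_size_eqp dv) s7 s8.
Qed.
End JouanolouFoliation.

(** * Existence of the involution and genericity *)

Section Involution.
Variable K : numClosedFieldType.
Variables (F : 'I_3 -> {mpoly K[3]}) (c : nat -> nat -> K).
Hypothesis FE : forall m, eval_forms F m = omega c m.

Lemma field_form_const n : field_form 0 (fun _ : 'rV[K]_n => c).
Proof. by move=> i j; apply: form_const. Qed.

Lemma vector_form_id : vector_form 1 (fun m : 'rV[K]_3 => m).
Proof. by move=> i; apply: form_coord. Qed.

(** The set where T(m) and a suitable component of omega(m') do not vanish is open,
    and it contains [m0]. *)
Lemma exists_associated m0 : m0 != 0 -> tanT c m0 != 0 ->
  omega c (involution c m0) != 0 ->
  exists phi, associated_involution F phi.
Proof.
move=> m00 T0 /rV0Pn[k fk].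
have inv_form := form_involution (field_form_const 3) vector_form_id.
have /fin_all_exists2[phi phi_homog phiE] := inv_form.
have evE m : eval_forms phi m = involution c m by apply/rowP => i; rewrite mxE phiE.
pose good m := tanT c m * omega c (involution c m) 0 k.
have good_open : zariski_open (fun m : 'rV[K]_3 => good m != 0).
  apply: form_open; apply: formM (form_tanT (field_form_const 3) vector_form_id) _.
  exact: form_omega (field_form_const 3) inv_form k.
have good0 : exists2 m, m != 0 & good m != 0 by exists m0; rewrite ?mulf_neq0.
have goodP m : good m != 0 -> tanT c m != 0 /\ omega c (involution c m) != 0.
  rewrite mulf_eq0 negb_or => /andP[-> fm]; split=> //.
  by apply/rV0Pn; exists k.
exists phi; split; last first.
  exists (fun m => good m != 0); split=> // m m_neq0 /goodP[T1 f1].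
  have fm := omega_neq0 T1; rewrite !evE.
  split=> [|||q /(tangent_atP FE _ fm m_neq0)[q0 fq fqm]].
  - by apply/(tangent_atP FE _ fm m_neq0); rewrite crossvv.
  - apply/(tangent_atP FE _ fm m_neq0); split=> //; first exact: involution_neq0.
    exact: omega_involution_colinear.
  - rewrite eqmx_cross ?involution_neq0 // crossC oppr_eq0; exact: cross_involution_neq0.
  - by have [/eqP|/eqP] := tangent_points T1 fq fqm; [left|right];
      rewrite eqmx_cross ?involution_neq0.
split.
  split; first by eexists; apply: phi_homog.
  have /rV0Pn[i pi] := involution_neq0 T0; exists i.
  by apply: contraNneq pi => phi0; rewrite -phiE phi0 meval0.
exists (fun m => good m != 0); split=> // m m_neq0 /goodP[T1 f1].
cbv zeta; rewrite !evE; have [pp0 ppm] := involution_involutive T1 f1.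
by split; [exact: involution_neq0 | exact: pp0 | rewrite eqmx_cross // ppm].
Qed.
End Involution.

Section Genericity.
Variable K : numClosedFieldType.
Notation N := #|{: 'I_3 * 'X_{1..3 < 4}}|.

(** The default value of [insubd] is reached only for monomials of degree larger
    than 3. *)
Definition coord_coef (x : 'rV[K]_N) (i : 'I_3) (a b d : nat) : K :=
  x 0 (enum_rank (i, insubd (bm0 : 'X_{1..3 < 4}) (mnm3 a b d))).

Lemma coord_coefE (F : 'I_3 -> {mpoly K[3]}) i a b d : (a + b + d < 4)%N ->
  coord_coef (foliation_coords 2 F) i a b d = form_coef F i a b d.
Proof.
by move=> abd; rewrite /coord_coef mxE enum_rankK /= insubdK // -topredE /= mdeg_mnm3.
Qed.

Lemma field_of_coords (F : 'I_3 -> {mpoly K[3]}) :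
  field_of (coord_coef (foliation_coords 2 F)) = field_of (form_coef F).
Proof. by rewrite /field_of !coord_coefE. Qed.

Lemma field_of_form : field_form 1 (fun x => field_of (coord_coef x)).
Proof.
move=> i j; have Hx k a b d : form_fun 1 (fun x => coord_coef x k a b d) by apply: form_coord.
case: i => [|[|[|i]]]; case: j => [|[|[|[|[|j]]]]]; rewrite /field_of /= ?nth_nil;
  by [exact: Hx | apply: formN; apply: Hx | exact: form0].
Qed.

Definition base_pt : 'rV[K]_3 := v3 1 1 0.

(** The factors say that (0 : 1 : 0) is not singular, that no line is invariant, that
    the eliminant has seven simple roots, and that the involution is defined at one
    point, with a regular image. *)
Definition generic_fun c : K :=
  c%(0,0) * \det (line_cert c) * disc c *
  (tanT c base_pt * omega c (involution c base_pt) 0 iz).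

Lemma generic_fun_open :
  zariski_open (fun x => generic_fun (field_of (coord_coef x)) != 0).
Proof.
have Hc := field_of_form.
have Hm : vector_form 0 (fun _ : 'rV[K]_N => base_pt) by move=> i; apply: form_const.
apply: form_open; do 3?apply: formM.
- exact: Hc.
- exact: form_line_cert.
- exact: form_disc.
- exact: form_tanT Hc Hm.
- exact: form_omega Hc (form_involution Hc Hm) iz.
Qed.

Lemma generic_fun_jouanolou : generic_fun (jouanolou K) != 0.
Proof.
have quadJ x y z : quad (jouanolou K) (v3 x y z) = v3 (y ^+ 2) (z ^+ 2) (x ^+ 2).
  by rewrite quad_v3 /jouanolou /=; congr v3; ring.
have omegaJ : omega (jouanolou K) base_pt = v3 1 (-1) (-1).
  by rewrite /omega quadJ; vec.
have TE : tanT (jouanolou K) base_pt = - 2.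
  rewrite /tanT omegaJ quadJ polar_v3 /jouanolou /=; sca.
have invE : involution (jouanolou K) base_pt = v3 0 (-2) 2.
  by rewrite /involution TE /tanS omegaJ /base_pt !quadJ dot_v3 !mxE; vec.
rewrite /generic_fun !mulf_neq0 ?jouanolou_line_cert ?jouanolou_disc //.
- by rewrite /jouanolou /= oner_eq0.
- by rewrite TE oppr_eq0 pnatr_eq0.
- rewrite invE /omega quadJ (_ : _ 0 iz = 8); first by rewrite pnatr_eq0.
  by rewrite /cross /v3 !mxE /=; ring.
Qed.

Lemma generic_foliation_geiser :
  generic_foliation 2 (fun F : 'I_3 -> {mpoly K[3]} =>
    (exists phi, associated_involution F phi) /\
    (forall phi, associated_involution F phi -> geiser_involution phi)).
Proof.
exists (fun x => generic_fun (field_of (coord_coef x)) != 0); split.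
- exact: generic_fun_open.
- exists (@jouanolou_form K); first exact: jouanolou_foliation.
  by rewrite field_of_coords jouanolou_field generic_fun_jouanolou.
move=> F Ffol; rewrite field_of_coords; set c := field_of _.
rewrite /generic_fun !mulf_eq0 !negb_or => /andP[/andP[/andP[c00 cert] dsc] /andP[T0 f0]].
have FE m : eval_forms F m = omega c m by apply: foliation_eval.
have F_homog : forall i, F i \is 3.-homog by case: Ffol.
have nil := line_cert_no_invariant_line cert.
have [p sp] := exists_singular_config c00 dsc.
split; last by move=> phi; apply: (associated_geiser F_homog FE nil sp).
apply: (exists_associated FE _ T0).
  by apply/rV0Pn; exists ix; rewrite mxE /= oner_eq0.
by apply/rV0Pn; exists iz.
Qed.
End Genericity.

Theorem mainTheorem2 (R : realType) :
  generic_foliation 2 (fun F : 'I_3 -> {mpoly (complex R)[3]} =>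
    (exists phi, associated_involution F phi) /\
    (forall phi, associated_involution F phi -> geiser_involution phi)).
Proof. exact: generic_foliation_geiser. Qed.
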